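(* Let $Q_1$ and $Q_2$ be finite directed graphs. The algebras $OA(Q_1)$ and $OA(Q_2)$ are isomorphic as Banach algebras if and only if $Q_1$ and $Q_2$ are isomorphic as directed graphs.
   Context: A directed graph $Q$ has vertex set $V(Q)$, edge set $E(Q)$ and range and source maps $r,s:E(Q)\to V(Q)$; it is finite if $V(Q)$ and $E(Q)$ are finite. Loops and multiple edges are allowed. A contractive representation of $Q$ on a Hilbert space $H$ is a map $\pi:V(Q)\cup E(Q)\to B(H)$ with each $\pi(v)$ ($v\in V(Q)$) a projection (distinct vertices are not required to give orthogonal projections), each $\pi(e)$ ($e\in E(Q)$) a contraction, and $\pi(r(e))\pi(e)=\pi(e)=\pi(e)\pi(s(e))$ for all $e\in E(Q)$. The universal operator algebra $OA(Q)$ is the norm closed operator algebra generated by a universal such family $\{P_v\}_{v\in V(Q)},\{T_e\}_{e\in E(Q)}$: it is the completion of the complex algebra generated by $V(Q)\cup E(Q)$ subject to the relations $vv=v$, $r(e)e=e=e\,s(e)$, in the matrix norms given by the supremum over all contractive representations of $Q$. Every contractive representation of $Q$ extends uniquely to a completely contractive representation of $OA(Q)$. An isomorphism of Banach algebras is a bounded algebra isomorphism with bounded inverse (not necessarily isometric). An isomorphism of directed graphs is a pair of bijections of vertex sets and edge sets commuting with the range and source maps. *)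

(* Defs.v *)
From HB Require Import structures.
From mathcomp Require Import all_boot all_order all_algebra.
From mathcomp Require Import sesquilinear generic_quotient complex.
From mathcomp Require Import boolp classical_sets reals topology normedtype.
From mathcomp Require Import sequences.

Set Implicit Arguments.
Unset Strict Implicit.
Unset Printing Implicit Defensive.
Import Order.TTheory GRing.Theory Num.Theory.
Import numFieldNormedType.Exports.
Local Open Scope complex_scope.
Local Open Scope classical_set_scope.
Local Open Scope ring_scope.

Record fin_digraph := FinDigraph {
  vert : finType;
  edge : finType;
  rng : edge -> vert;
  src : edge -> vert }.

Definition digraph_isomorphic (Q1 Q2 : fin_digraph) : Prop :=
  exists (f : vert Q1 -> vert Q2) (g : edge Q1 -> edge Q2),
    [/\ bijective f, bijective g,
        forall e, rng (g e) = f (rng e) &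
        forall e, src (g e) = f (src e)].

(* The inner product is linear in its first argument. Zero-dimensional and
   nonseparable spaces are included. *)
Record hilbert (R : realType) := Hilbert {
  hilbert_sort :> completeNormedModType R[i];
  hdot : {dot hilbert_sort for Num.conj};
  hdotE : forall x, hdot x x = `|x| ^+ 2 }.

Arguments hdot {R h}.

(* Not necessarily unital. *)
HB.mixin Record CompleteNormedModule_isBanachAlgebra (K : numFieldType) A
    & CompleteNormedModule K A := {
  bmul : A -> A -> A;
  bmulA : associative bmul;
  bmulDl : left_distributive bmul +%R;
  bmulDr : right_distributive bmul +%R;
  bmulZl : forall (c : K) (a b : A), bmul (c *: a) b = c *: bmul a b;
  bmulZr : forall (c : K) (a b : A), bmul a (c *: b) = c *: bmul a b;
  norm_bmul : forall a b : A, `|bmul a b| <= `|a| * `|b| }.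

#[short(type="banachAlgType")]
HB.structure Definition BanachAlgebra (K : numFieldType) :=
  {A of CompleteNormedModule K A & CompleteNormedModule_isBanachAlgebra K A}.

Definition bounded_op (K : numFieldType) (A B : normedModType K)
  (f : A -> B) : Prop := exists M : K, forall a, `|f a| <= M * `|a|.

(* The inverse [g] is automatically linear and multiplicative. *)
Definition banach_isomorphic (K : numFieldType) (A B : banachAlgType K)
    : Prop :=
  exists (f : {linear A -> B}) (g : B -> A),
    [/\ forall a b, f (bmul a b) = bmul (f a) (f b),
        cancel f g, cancel g f, bounded_op f & bounded_op g].

Section Representations.
Variables (R : realType) (Q : fin_digraph).

(* A linear self-adjoint idempotent is automatically bounded, so [projection]
   and [contraction] carve out elements of B(H) among the linear maps. *)
Definition projection (H : hilbert R) (P : H -> H) : Prop :=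
  (forall x, P (P x) = P x) /\ (forall x y, hdot (P x) y = hdot x (P y)).

Definition contraction (H : hilbert R) (T : H -> H) : Prop :=
  forall x, `|T x| <= `|x|.

Record crep := CRep {
  rep_sp : hilbert R;
  rep_v : vert Q -> {linear rep_sp -> rep_sp};
  rep_e : edge Q -> {linear rep_sp -> rep_sp};
  rep_v_proj : forall v, projection (rep_v v);
  rep_e_contr : forall e, contraction (rep_e e);
  rep_rng : forall e x, rep_v (rng e) (rep_e e x) = rep_e e x;
  rep_src : forall e x, rep_e e (rep_v (src e) x) = rep_e e x }.

(* Expressions for the elements of the (nonunital) complex algebra generated by
   the vertices and edges. The algebra axioms and the relations
   vv = v, r(e)e = e = e s(e) hold in every contractive representation, hence
   are imposed when expressions at distance 0 for [unorm] are identified. *)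
Inductive term : Type :=
  | TZero
  | TVert of vert Q
  | TEdge of edge Q
  | TAdd of term & term
  | TScale of R[i] & term
  | TMul of term & term.

Fixpoint ev (pi : crep) (p : term) : rep_sp pi -> rep_sp pi :=
  match p with
  | TZero => fun=> 0
  | TVert v => rep_v pi v
  | TEdge e => rep_e pi e
  | TAdd p q => fun x => ev p x + ev q x
  | TScale c p => fun x => c *: ev p x
  | TMul p q => fun x => ev p (ev q x)
  end.

(* Norms take their values in R[i]; [complex.Re] recovers the real number. *)
Definition opnorm (H : hilbert R) (f : H -> H) : R :=
  sup [set complex.Re `|f x| | x in [set x | `|x| <= 1]].

(* A finite supremum, by [ev_bound]. *)
Definition unorm (p : term) : R :=
  sup [set r | exists pi : crep, r = opnorm (@ev pi p)].

Lemma normC_Re (V : normedModType R[i]) (x : V) :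
  (complex.Re `|x|)%:C = `|x|.
Proof. by apply: RRe_real; apply: normr_real. Qed.

Lemma Re_norm_ge0 (V : normedModType R[i]) (x : V) : 0 <= complex.Re `|x|.
Proof. by rewrite -ler0c normC_Re. Qed.

Lemma proj_contr (H : hilbert R) (P : {linear H -> H}) :
  projection P -> contraction P.
Proof.
move=> [PP Ps] x.
have py (y z : H) : hdot y z = 0 -> hdot z y = 0 ->
    hdot (y + z) (y + z) = hdot y y + hdot z z.
  by move=> yz zy; rewrite linearDl /= !linearDr /= yz zy addr0 add0r.
have PO : P (x - P x) = 0 by rewrite linearB /= PP subrr.
have := py (P x) (x - P x).
have -> : P x + (x - P x) = x by rewrite addrC subrK.
rewrite Ps PO linear0r => /(_ erefl).
rewrite -Ps PO linear0l => /(_ erefl).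
rewrite !hdotE => E.
by rewrite -(@ler_pXn2r _ 2) ?nnegrE// E lerDl exprn_ge0.
Qed.

Lemma ev_linear pi p : linear (@ev pi p).
Proof.
elim: p => //=.
- by move=> a x y; rewrite scaler0 addr0.
- by move=> v a x y; rewrite linearP.
- by move=> e a x y; rewrite linearP.
- by move=> p IHp q IHq a x y; rewrite IHp IHq scalerDr addrACA.
- move=> c p IHp a x y.
  by rewrite IHp scalerDr !scalerA mulrC.
- by move=> p IHp q IHq a x y; rewrite IHq IHp.
Qed.

HB.instance Definition _ pi p := GRing.isLinear.Build R[i]
  (rep_sp pi) (rep_sp pi) *:%R (@ev pi p) (@ev_linear pi p).

Fixpoint tbound (p : term) : R :=
  match p with
  | TZero => 0
  | TVert _ => 1
  | TEdge _ => 1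
  | TAdd p q => tbound p + tbound q
  | TScale c p => complex.Re `|c| * tbound p
  | TMul p q => tbound p * tbound q
  end.

Lemma Re_normc_ge0 (c : R[i]) : 0 <= complex.Re `|c|.
Proof. by case: c => a b /=; exact: sqrtr_ge0. Qed.

Lemma Re_normcE (c : R[i]) : (complex.Re `|c|)%:C = `|c|.
Proof. by apply: RRe_real; apply: normr_real. Qed.

Lemma tbound_ge0 p : 0 <= tbound p.
Proof.
elim: p => //=.
- by move=> p ? q ?; exact: addr_ge0.
- by move=> c p ?; rewrite mulr_ge0 // Re_normc_ge0.
- by move=> p ? q ?; exact: mulr_ge0.
Qed.

Lemma ev_bound pi p x : `|@ev pi p x| <= (tbound p)%:C * `|x|.
Proof.
elim: p x => [|v|e|p IHp q IHq|c p IHp|p IHp q IHq] x /=.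
- by rewrite normr0 mul0r.
- by rewrite mul1r; apply: proj_contr; exact: rep_v_proj.
- by rewrite mul1r; exact: rep_e_contr.
- rewrite rmorphD mulrDl; apply: le_trans (ler_normD _ _) _; exact: lerD.
- by rewrite normrZ rmorphM /= Re_normcE -mulrA ler_wpM2l.
- rewrite rmorphM /= -mulrA; apply: le_trans (IHp _) _.
  by rewrite ler_wpM2l // ler0c tbound_ge0.
Qed.

Lemma Re_le (x y : R[i]) : x <= y -> complex.Re x <= complex.Re y.
Proof. by rewrite lecE => /andP[]. Qed.

Lemma opnorm_le (H : hilbert R) (f : H -> H) (M : R) : 0 <= M ->
  (forall x, `|f x| <= M%:C * `|x|) -> opnorm f <= M.
Proof.
move=> M0 fM; apply: sup_le_ub; first by exists (complex.Re `|f 0|); exists 0; rewrite /= ?normr0.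
move=> _ [x /= x1 <-].
have : `|f x| <= M%:C.
  by apply: le_trans (fM x) _; rewrite -[leRHS]mulr1 ler_wpM2l // ler0c.
by move=> /Re_le.
Qed.

Lemma le_opnorm (H : hilbert R) (f : {linear H -> H}) (M : R) : 0 <= M ->
  (forall x, `|f x| <= M%:C * `|x|) ->
  forall x, `|f x| <= (opnorm f)%:C * `|x|.
Proof.
move=> M0 fM x.
have [->|x0] := eqVneq x 0; first by rewrite linear0 !normr0 mulr0.
have nx0 : 0 < `|x| by rewrite normr_gt0.
rewrite -ler_pdivrMr // -normC_Re.
rewrite -(normC_Re x) -(normC_Re (f x)).
set y := `|x|^-1 *: x.
have y1 : `|y| = 1.
  by rewrite /y normrZ normfV normr_id mulVf // gt_eqF.
have -> : (complex.Re `|f x|)%:C / (complex.Re `|x|)%:C = `|f y|.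
  by rewrite !normC_Re /y linearZ /= normrZ normfV normr_id mulrC.
rewrite -normC_Re lecR; apply: ub_le_sup; last by exists y => //=; rewrite y1.
exists M => _ [z /= z1 <-].
have : `|f z| <= M%:C.
  by apply: le_trans (fM z) _; rewrite -[leRHS]mulr1 ler_wpM2l // ler0c.
by move=> /Re_le.
Qed.

Lemma unorm_le p (M : R) : 0 <= M ->
  (forall pi x, `|@ev pi p x| <= M%:C * `|x|) -> unorm p <= M.
Proof.
move=> M0 pM; rewrite /unorm.
have [->|/set0P ne] := eqVneq [set r | exists pi : crep, r = opnorm (@ev pi p)] set0.
  by rewrite sup0.
by apply: sup_le_ub => // _ [pi ->]; apply: opnorm_le.
Qed.

Lemma ev_le pi p x : `|@ev pi p x| <= (unorm p)%:C * `|x|.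
Proof.
apply: le_trans (le_opnorm (tbound_ge0 p) (@ev_bound pi p) x) _.
rewrite ler_wpM2r // lecR; apply: ub_le_sup; last by exists pi.
exists (tbound p) => _ [pi' ->].
by apply: opnorm_le (tbound_ge0 p) _; exact: ev_bound.
Qed.

Definition tsub (p q : term) : term := TAdd p (TScale (-1) q).

Lemma ev_sub pi p q x : @ev pi (tsub p q) x = ev p x - ev q x.
Proof. by rewrite /= scaleN1r. Qed.

Lemma sup_nneg (A : set R) : (forall r, A r -> 0 <= r) -> 0 <= sup A.
Proof.
move=> A0; have [sA|/sup_out -> //] := pselect (has_sup A).
have [[r Ar] _] := sA; apply: le_trans (A0 _ Ar) _.
by apply: ub_le_sup => //; case: sA.
Qed.

Lemma unorm_ge0 p : 0 <= unorm p.
Proof.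
rewrite /unorm; apply: sup_nneg => _ [pi ->].
by apply: sup_nneg => _ [x _ <-]; exact: Re_norm_ge0.
Qed.

Let tdist (p q : term) : R := unorm (tsub p q).

Lemma tdistxx p : tdist p p = 0.
Proof.
apply/eqP; rewrite eq_le unorm_ge0 andbT; apply: unorm_le => // pi x.
by rewrite ev_sub subrr normr0 mul0r.
Qed.

Lemma tdistC p q : tdist p q = tdist q p.
Proof.
by apply/eqP; rewrite eq_le; apply/andP; split;
  apply: unorm_le (unorm_ge0 _) _ => pi x;
  rewrite ev_sub distrC -ev_sub ev_le.
Qed.

Lemma tdist_triangle p q r : tdist p r <= tdist p q + tdist q r.
Proof.
apply: unorm_le => [|pi x]; first by rewrite addr_ge0 ?unorm_ge0.
rewrite ev_sub -(subrKA (ev q x)) rmorphD mulrDl.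
apply: le_trans (ler_normD _ _) _.
by apply: lerD; rewrite -ev_sub ev_le.
Qed.

Lemma tdist_ev p q : (forall pi x, @ev pi p x = @ev pi q x) -> tdist p q = 0.
Proof.
move=> pq; apply/eqP; rewrite eq_le unorm_ge0 andbT.
by apply: unorm_le => // pi x; rewrite ev_sub pq subrr normr0 mul0r.
Qed.

Lemma unormD p q : unorm (TAdd p q) <= unorm p + unorm q.
Proof.
apply: unorm_le => [|pi x]; first by rewrite addr_ge0 ?unorm_ge0.
rewrite rmorphD mulrDl; apply: le_trans (ler_normD _ _) _.
by apply: lerD; exact: ev_le.
Qed.

Lemma unormZ_le c p : unorm (TScale c p) <= complex.Re `|c| * unorm p.
Proof.
apply: unorm_le => [|pi x].
  by rewrite mulr_ge0 ?unorm_ge0 ?Re_normc_ge0.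
by rewrite normrZ rmorphM /= Re_normcE -mulrA ler_wpM2l // ev_le.
Qed.

Lemma unormM p q : unorm (TMul p q) <= unorm p * unorm q.
Proof.
apply: unorm_le => [|pi x]; first by rewrite mulr_ge0 ?unorm_ge0.
rewrite rmorphM /= -mulrA; apply: le_trans (ev_le _ _) _.
by rewrite ler_wpM2l ?ler0c ?unorm_ge0 // ev_le.
Qed.

Lemma unorm_ev p q : (forall pi x, `|@ev pi p x| = `|@ev pi q x|) ->
  unorm p = unorm q.
Proof.
move=> pq; apply/eqP; rewrite eq_le; apply/andP; split;
  apply: unorm_le (unorm_ge0 _) _ => pi x.
  by rewrite pq ev_le.
by rewrite -pq ev_le.
Qed.

Lemma unormZ c p : unorm (TScale c p) = complex.Re `|c| * unorm p.
Proof.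
apply/eqP; rewrite eq_le unormZ_le andTb.
have [->|c0] := eqVneq c 0.
  by rewrite normr0 mul0r unorm_ge0.
have c0' : 0 < complex.Re `|c| by rewrite -ltcR Re_normcE normr_gt0.
rewrite mulrC -ler_pdivlMr // mulrC.
have -> : unorm p = unorm (TScale c^-1 (TScale c p)).
  by apply: unorm_ev => pi x /=; rewrite scalerA mulVf // scale1r.
apply: le_trans (unormZ_le _ _) _; rewrite le_eqVlt; apply/orP; left.
apply/eqP; congr (_ * _); apply: complexI.
by rewrite Re_normcE normfV fmorphV /= Re_normcE.
Qed.

Lemma unorm0 : unorm TZero = 0.
Proof.
apply/eqP; rewrite eq_le unorm_ge0 andbT.
by apply: unorm_le => // pi x; rewrite normr0 mul0r.
Qed.

Lemma unorm_dist p q : `|unorm p - unorm q| <= tdist p q.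
Proof.
have h p' q' : unorm p' <= tdist p' q' + unorm q'.
  apply: le_trans (unormD _ _).
  by rewrite (@unorm_ev _ (TAdd (tsub p' q') q')) // => pi x;
    rewrite /= scaleN1r subrK.
rewrite ler_norml lerBlDr h andbT lerNl opprB lerBlDr tdistC; exact: h.
Qed.

Lemma tdist_add p p' q q' :
  tdist (TAdd p q) (TAdd p' q') <= tdist p p' + tdist q q'.
Proof.
apply: le_trans (unormD _ _); rewrite le_eqVlt; apply/orP; left; apply/eqP.
by apply: unorm_ev => pi x; rewrite /= !scaleN1r opprD addrACA.
Qed.

Lemma tdist_scale c p p' :
  tdist (TScale c p) (TScale c p') = complex.Re `|c| * tdist p p'.
Proof.
rewrite -unormZ; apply: unorm_ev => pi x.
by rewrite ev_sub /= scaleN1r scalerBr.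
Qed.

Lemma tdist_mul p p' q q' :
  tdist (TMul p q) (TMul p' q') <= unorm p * tdist q q' + tdist p p' * unorm q'.
Proof.
apply: le_trans (lerD (unormM _ _) (unormM _ _)).
apply: le_trans (unormD _ _); rewrite le_eqVlt; apply/orP; left; apply/eqP.
by apply: unorm_ev => pi x; rewrite /= !scaleN1r linearB /= addrA subrK.
Qed.

Definition tcauchy (u : nat -> term) : Prop :=
  forall eps : R, 0 < eps -> exists N, forall m n,
    (N <= m)%N -> (N <= n)%N -> unorm (tsub (u m) (u n)) < eps.

Record cseq := CSeq { cseq_fun :> nat -> term; cseqP : tcauchy cseq_fun }.

HB.instance Definition _ := gen_eqMixin cseq.
HB.instance Definition _ := gen_choiceMixin cseq.

Definition ceq (u v : cseq) : bool :=
  `[< (fun n => unorm (tsub (u n) (v n))) @ \oo --> (0 : R) >].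

Lemma ceqP (u v : cseq) : reflect (forall eps : R, 0 < eps -> exists N,
  forall n, (N <= n)%N -> tdist (u n) (v n) < eps) (ceq u v).
Proof.
apply: (iffP (asboolP _)) => [/cvgrPdist_lt h eps /h [N _ hN]|h].
  exists N => n /hN /=; rewrite sub0r normrN ger0_norm //; exact: unorm_ge0.
apply/cvgrPdist_lt => eps /h [N hN]; exists N => // n /= /hN.
by rewrite sub0r normrN ger0_norm ?unorm_ge0.
Qed.

Lemma ceq_equiv : equiv_class_of ceq.
Proof.
split=> [u|u v|v u w].
- by apply/ceqP => eps e0; exists 0 => n _; rewrite tdistxx.
- by apply/ceqP/ceqP => h eps /h [N hN]; exists N => n /hN; rewrite tdistC.
- move=> /ceqP uv /ceqP vw; apply/ceqP => eps e0.
  have e2 : 0 < eps / 2 by rewrite divr_gt0.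
  have [N1 h1] := uv _ e2; have [N2 h2] := vw _ e2.
  exists (maxn N1 N2) => n; rewrite geq_max => /andP[n1 n2].
  apply: le_lt_trans (tdist_triangle _ (v n) _) _.
  by rewrite (splitr eps) ltrD ?h1 ?h2.
Qed.

Canonical ceq_equivRel := EquivRelPack ceq_equiv.

(* The universal operator algebra of Q: the completion of the generated algebra
   for the supremum of the operator norms over all contractive representations,
   as Cauchy sequences modulo null sequences. Its operations and norm are
   defined below; [OA_norm_of], [OA_dense] and [OA_complete] say that it is
   this completion. *)
Definition OA : Type := {eq_quot ceq}%qT.
HB.instance Definition _ := Choice.on OA.
HB.instance Definition _ := EqQuotient.on OA.

Definition cls (u : cseq) : OA := \pi_OA%qT u.

Lemma clsP u v : cls u = cls v <-> ceq u v.
Proof. by split=> [/eqmodP|h] //; apply/eqmodP. Qed.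

Lemma cls_surj (a : OA) : exists u, a = cls u.
Proof. by exists (repr a); rewrite /cls reprK. Qed.

Lemma ceq_repr u : ceq (repr (cls u)) u.
Proof. by apply/clsP; rewrite /cls reprK. Qed.

Lemma cls_ev (u v : cseq) :
  (forall n pi x, @ev pi (u n) x = @ev pi (v n) x) -> cls u = cls v.
Proof.
by move=> uv; apply/clsP/ceqP => eps e0; exists 0 => n _; rewrite tdist_ev.
Qed.

Lemma tcauchy_cst p : tcauchy (fun=> p).
Proof. by move=> eps e0; exists 0 => m n _ _; rewrite -/(tdist _ _) tdistxx. Qed.

Lemma tcauchy_add (u v : cseq) : tcauchy (fun n => TAdd (u n) (v n)).
Proof.
move=> eps e0; have e2 : 0 < eps / 2 by rewrite divr_gt0.
have [N1 h1] := cseqP u e2; have [N2 h2] := cseqP v e2.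
exists (maxn N1 N2) => m n; rewrite !geq_max => /andP[m1 m2] /andP[n1 n2].
apply: le_lt_trans (tdist_add _ _ _ _) _.
by rewrite (splitr eps) ltrD ?h1 ?h2.
Qed.

Lemma tcauchy_scale c (u : cseq) : tcauchy (fun n => TScale c (u n)).
Proof.
move=> eps e0; have c0 : 0 < complex.Re `|c| + 1.
  by rewrite ltr_wpDl ?Re_normc_ge0.
have [N h] := cseqP u (divr_gt0 e0 c0).
exists N => m n Nm Nn; rewrite -/(tdist _ _) tdist_scale.
have := h _ _ Nm Nn; rewrite ltr_pdivlMr //; apply: le_lt_trans.
by rewrite mulrC ler_wpM2l ?unorm_ge0 // lerDl.
Qed.

Lemma cseq_bounded (u : cseq) :
  exists2 M : R, 0 < M & exists N, forall n, (N <= n)%N -> unorm (u n) <= M.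
Proof.
have [N h] := cseqP u ltr01.
exists (1 + unorm (u N)); first by rewrite ltr_wpDr ?unorm_ge0.
exists N => n Nn; rewrite -lerBlDr.
apply: le_trans (ltW (h n N Nn (leqnn N))).
by apply: le_trans (unorm_dist _ _); exact: ler_norm.
Qed.

Lemma tcauchy_mul (u v : cseq) : tcauchy (fun n => TMul (u n) (v n)).
Proof.
move=> eps e0.
have [Mu Mu0 [Nu hu]] := cseq_bounded u.
have [Mv Mv0 [Nv hv]] := cseq_bounded v.
have e2 : 0 < eps / 2 by rewrite divr_gt0.
have [N1 h1] := cseqP u (divr_gt0 e2 Mv0).
have [N2 h2] := cseqP v (divr_gt0 e2 Mu0).
exists (maxn (maxn Nu Nv) (maxn N1 N2)) => m n.
rewrite !geq_max => /andP[/andP[mu mv] /andP[m1 m2]].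
move=> /andP[/andP[nu nv] /andP[n1 n2]].
apply: le_lt_trans (tdist_mul _ _ _ _) _.
rewrite (splitr eps); apply: ltrD.
  have := h2 _ _ m2 n2; rewrite ltr_pdivlMr //; apply: le_lt_trans.
  by rewrite mulrC ler_wpM2l ?unorm_ge0 // hu.
have := h1 _ _ m1 n1; rewrite ltr_pdivlMr //; apply: le_lt_trans.
by rewrite ler_wpM2l ?unorm_ge0 // hv.
Qed.

Definition ccst p := CSeq (tcauchy_cst p).
Definition cadd u v := CSeq (tcauchy_add u v).
Definition cscale c u := CSeq (tcauchy_scale c u).
Definition cmul u v := CSeq (tcauchy_mul u v).

Lemma ceq_add u u' v v' : ceq u u' -> ceq v v' -> ceq (cadd u v) (cadd u' v').
Proof.
move=> /ceqP hu /ceqP hv; apply/ceqP => eps e0.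
have e2 : 0 < eps / 2 by rewrite divr_gt0.
have [N1 h1] := hu _ e2; have [N2 h2] := hv _ e2.
exists (maxn N1 N2) => n; rewrite geq_max => /andP[n1 n2].
apply: le_lt_trans (tdist_add _ _ _ _) _.
by rewrite (splitr eps) ltrD ?h1 ?h2.
Qed.

Lemma ceq_scale c u u' : ceq u u' -> ceq (cscale c u) (cscale c u').
Proof.
move=> /ceqP hu; apply/ceqP => eps e0.
have c0 : 0 < complex.Re `|c| + 1 by rewrite ltr_wpDl ?Re_normc_ge0.
have [N h] := hu _ (divr_gt0 e0 c0).
exists N => n Nn; rewrite tdist_scale.
have := h _ Nn; rewrite ltr_pdivlMr //; apply: le_lt_trans.
by rewrite mulrC ler_wpM2l ?unorm_ge0 // lerDl.
Qed.

Lemma ceq_mul u u' v v' : ceq u u' -> ceq v v' -> ceq (cmul u v) (cmul u' v').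
Proof.
move=> /ceqP huu /ceqP hvv; apply/ceqP => eps e0.
have [Mu Mu0 [Nu hu]] := cseq_bounded u.
have [Mv Mv0 [Nv hv]] := cseq_bounded v'.
have e2 : 0 < eps / 2 by rewrite divr_gt0.
have [N1 h1] := huu _ (divr_gt0 e2 Mv0).
have [N2 h2] := hvv _ (divr_gt0 e2 Mu0).
exists (maxn (maxn Nu Nv) (maxn N1 N2)) => n.
rewrite !geq_max => /andP[/andP[nu nv] /andP[n1 n2]].
apply: le_lt_trans (tdist_mul _ _ _ _) _.
rewrite (splitr eps); apply: ltrD.
  have := h2 _ n2; rewrite ltr_pdivlMr //; apply: le_lt_trans.
  by rewrite mulrC ler_wpM2l ?unorm_ge0 // hu.
have := h1 _ n1; rewrite ltr_pdivlMr //; apply: le_lt_trans.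
by rewrite ler_wpM2l ?unorm_ge0 // hv.
Qed.

Definition OA_of (p : term) : OA := cls (ccst p).
Definition OA_add (a b : OA) : OA := cls (cadd (repr a) (repr b)).
Definition OA_scale (c : R[i]) (a : OA) : OA := cls (cscale c (repr a)).
Definition OA_opp (a : OA) : OA := OA_scale (-1) a.
Definition OA_mul (a b : OA) : OA := cls (cmul (repr a) (repr b)).
Definition OA_norm (a : OA) : R := limn (fun n => unorm (repr a n)).

Lemma OA_addE u v : OA_add (cls u) (cls v) = cls (cadd u v).
Proof. by apply/clsP/ceq_add; exact: ceq_repr. Qed.

Lemma OA_scaleE c u : OA_scale c (cls u) = cls (cscale c u).
Proof. by apply/clsP/ceq_scale; exact: ceq_repr. Qed.

Lemma OA_mulE u v : OA_mul (cls u) (cls v) = cls (cmul u v).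
Proof. by apply/clsP/ceq_mul; exact: ceq_repr. Qed.

Lemma OA_addA : associative OA_add.
Proof.
move=> a b c; have [u ->] := cls_surj a; have [v ->] := cls_surj b.
have [w ->] := cls_surj c; rewrite !OA_addE.
by apply: cls_ev => n pi x /=; rewrite addrA.
Qed.

Lemma OA_addC : commutative OA_add.
Proof.
move=> a b; have [u ->] := cls_surj a; have [v ->] := cls_surj b.
by rewrite !OA_addE; apply: cls_ev => n pi x /=; rewrite addrC.
Qed.

Lemma OA_add0 : left_id (OA_of TZero) OA_add.
Proof.
move=> a; have [u ->] := cls_surj a.
by rewrite OA_addE; apply: cls_ev => n pi x /=; rewrite add0r.
Qed.

Lemma OA_addN : left_inverse (OA_of TZero) OA_opp OA_add.
Proof.
move=> a; have [u ->] := cls_surj a.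
rewrite /OA_opp OA_scaleE OA_addE; apply: cls_ev => n pi x /=.
by rewrite scaleN1r addNr.
Qed.

HB.instance Definition _ :=
  GRing.isZmodule.Build OA OA_addA OA_addC OA_add0 OA_addN.

Lemma OA_scaleA c d (a : OA) : OA_scale c (OA_scale d a) = OA_scale (c * d) a.
Proof.
have [u ->] := cls_surj a; rewrite !OA_scaleE.
by apply: cls_ev => n pi x /=; rewrite scalerA.
Qed.

Lemma OA_scale1 : left_id 1 OA_scale.
Proof.
move=> a; have [u ->] := cls_surj a; rewrite !OA_scaleE.
by apply: cls_ev => n pi x /=; rewrite scale1r.
Qed.

Lemma OA_scaleDr : right_distributive OA_scale +%R.
Proof.
move=> c a b; have [u ->] := cls_surj a; have [v ->] := cls_surj b.
rewrite /GRing.add /= OA_addE !OA_scaleE OA_addE.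
by apply: cls_ev => n pi x /=; rewrite scalerDr.
Qed.

Lemma OA_scaleDl (a : OA) : {morph OA_scale^~ a : c d / c + d}.
Proof.
move=> c d /=; have [u ->] := cls_surj a.
rewrite !OA_scaleE [RHS]OA_addE.
by apply: cls_ev => n pi x /=; rewrite scalerDl.
Qed.

HB.instance Definition _ := GRing.Zmodule_isLmodule.Build R[i] OA
  OA_scaleA OA_scale1 OA_scaleDr OA_scaleDl.

Lemma is_cvg_unorm (u : cseq) : cvgn (fun n => unorm (u n)).
Proof.
apply/cauchy_cvgP/cauchy_exP => eps e0.
have [N h] := cseqP u e0; exists (unorm (u N)), N => // n /= Nn.
by apply: le_lt_trans (unorm_dist _ _) _; exact: h.
Qed.

Lemma OA_normE u : OA_norm (cls u) = limn (fun n => unorm (u n)).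
Proof.
have /ceqP h := ceq_repr u.
apply/esym/cvg_lim => //; rewrite /OA_norm.
set l := limn _.
have hl : (fun n => unorm (repr (cls u) n)) @ \oo --> l.
  exact: is_cvg_unorm.
rewrite -[l]addr0.
have -> : (fun n => unorm (u n)) =
  (fun n => unorm (repr (cls u) n) + (unorm (u n) - unorm (repr (cls u) n))).
  by apply/funext => n; rewrite addrC subrK.
apply: cvgD => //.
apply/cvgrPdist_lt => eps /h [N hN]; exists N => // n /= /hN.
rewrite sub0r normrN distrC; apply: le_lt_trans; exact: unorm_dist.
Qed.

Lemma OA_norm_of p : OA_norm (OA_of p) = unorm p.
Proof. by rewrite OA_normE /=; exact: lim_cst. Qed.

Lemma OA_norm_add a b : OA_norm (a + b) <= OA_norm a + OA_norm b.
Proof.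
have [u ->] := cls_surj a; have [v ->] := cls_surj b.
rewrite [_ + _ in leLHS]OA_addE !OA_normE -limD; try exact: is_cvg_unorm.
apply: ler_lim; first exact: is_cvg_unorm (cadd u v).
  by apply: is_cvgD; exact: is_cvg_unorm.
by near=> n; exact: unormD.
Unshelve. all: by end_near. Qed.

Lemma OA_norm_scale c a : OA_norm (c *: a) = complex.Re `|c| * OA_norm a.
Proof.
have [u ->] := cls_surj a; rewrite [_ *: _]OA_scaleE !OA_normE.
apply: cvg_lim => //.
have -> : (fun n => unorm (cscale c u n)) =
    (fun n => complex.Re `|c| * unorm (u n)).
  by apply/funext => n; exact: unormZ.
by apply: cvgM; [exact: cvg_cst|exact: is_cvg_unorm].
Qed.

Lemma OA_norm_mul a b : OA_norm (OA_mul a b) <= OA_norm a * OA_norm b.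
Proof.
have [u ->] := cls_surj a; have [v ->] := cls_surj b.
rewrite OA_mulE !OA_normE -limM; try exact: is_cvg_unorm.
apply: ler_lim; first exact: is_cvg_unorm (cmul u v).
  by apply: is_cvgM; exact: is_cvg_unorm.
by near=> n; exact: unormM.
Unshelve. all: by end_near. Qed.

Lemma OA_norm_eq0 a : OA_norm a = 0 -> a = 0.
Proof.
have [u ->] := cls_surj a; rewrite OA_normE => u0.
apply/clsP/ceqP => eps e0.
have : (fun n => unorm (u n)) @ \oo --> (0 : R).
  by rewrite -u0; exact: is_cvg_unorm.
move=> /cvgrPdist_lt /(_ _ e0) [N _ hN]; exists N => n /hN /=.
rewrite sub0r normrN ger0_norm ?unorm_ge0 // /tdist.
rewrite (@unorm_ev _ (u n)) // => pi x.
by rewrite ev_sub /= subr0.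
Qed.

Let OA_normc_add (a b : OA) :
  (OA_norm (a + b))%:C <= (OA_norm a)%:C + (OA_norm b)%:C :> R[i].
Proof. by rewrite -rmorphD lecR OA_norm_add. Qed.

Let OA_normc_scale (c : R[i]) (a : OA) :
  (OA_norm (c *: a))%:C = `|c| * (OA_norm a)%:C :> R[i].
Proof. by rewrite OA_norm_scale rmorphM /= Re_normcE. Qed.

Let OA_normc_eq0 (a : OA) : (OA_norm a)%:C = 0 :> R[i] -> a = 0.
Proof. by move=> /complexI; exact: OA_norm_eq0. Qed.

HB.instance Definition _ := Lmodule_isNormed.Build R[i] OA
  OA_normc_add OA_normc_scale OA_normc_eq0.

Lemma OA_normcE (a : OA) : `|a| = (OA_norm a)%:C.
Proof. by []. Qed.

Lemma OA_sub u v : cls u - cls v = cls (cadd u (cscale (-1) v)).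
Proof. by rewrite -OA_addE -OA_scaleE. Qed.

Lemma OA_dist_le (u v : cseq) N eps :
  (forall n, (N <= n)%N -> tdist (u n) (v n) <= eps) ->
  OA_norm (cls u - cls v) <= eps.
Proof.
move=> h; rewrite OA_sub OA_normE; apply: limr_le.
  exact: is_cvg_unorm (cadd u (cscale (-1) v)).
by exists N.
Qed.

Lemma OA_dist_of p q : OA_norm (OA_of p - OA_of q) = tdist p q.
Proof. by rewrite OA_sub OA_normE /=; exact: lim_cst. Qed.

Lemma OA_dense (a : OA) (eps : R) : 0 < eps ->
  exists p, OA_norm (a - OA_of p) <= eps.
Proof.
move=> e0; have [u ->] := cls_surj a; have [N h] := cseqP u e0.
exists (u N); apply: (@OA_dist_le _ _ N) => n Nn.
exact: ltW (h _ _ Nn (leqnn N)).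
Qed.

Lemma OA_complete (F : set_system OA) : ProperFilter F -> cauchy F -> cvg F.
Proof.
move=> FF /cauchyP Fc.
pose d (n : nat) : R := n.+1%:R^-1.
have d0 n : 0 < d n by rewrite invr_gt0 ltr0n.
have dle m n : (n <= m)%N -> d m <= d n.
  by move=> nm; rewrite lef_pV2 ?posrE ?ltr0n // ler_nat.
have /choice [p hp] : forall n, exists p, F (ball (OA_of p) (d n + d n)%:C).
  move=> n; have dC : 0 < (d n)%:C :> R[i] by rewrite ltcR.
  have [a Fa] := Fc _ dC; have [p hp] := OA_dense a (d0 n).
  exists p; apply: filterS Fa => x; rewrite -!ball_normE /ball_ /= => ax.
  rewrite -(subrKA a) rmorphD; apply: le_lt_trans (ler_normD _ _) _.
  by apply: ler_ltD => //; rewrite distrC OA_normcE lecR.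
have pd m n : tdist (p m) (p n) < (d m + d m) + (d n + d n).
  rewrite -OA_dist_of -ltcR -OA_normcE.
  have [x []] := filter_ex (filterI (hp m) (hp n)).
  rewrite -!ball_normE /ball_ /= => xm xn.
  rewrite -(subrKA x) rmorphD; apply: le_lt_trans (ler_normD _ _) _.
  by apply: ltrD => //; rewrite distrC.
have small (eps : R) : 0 < eps -> exists N, forall n, (N <= n)%N -> d n < eps.
  move=> e0; have /cvgrPdist_lt /(_ _ e0) [N _ h] := @cvg_harmonic R.
  by exists N => n /h; rewrite /= sub0r normrN (ger0_norm (ltW (d0 n))).
have pc : tcauchy p.
  move=> eps e0.
  have e4 : 0 < eps / 2 / 2 by rewrite !divr_gt0.
  have [N h] := small _ e4; exists N => m n mN nN.
  apply: lt_trans (pd m n) _.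
  by rewrite [ltRHS]splitr; apply: ltrD; rewrite [ltRHS]splitr ltrD ?h.
apply/cvg_ex; exists (cls (CSeq pc)).
apply/cvgrPdist_lt => eps e0.
have eE : (complex.Re eps)%:C = eps by apply: RRe_real; exact: gtr0_real.
have e0' : 0 < complex.Re eps by rewrite -ltcR eE.
have e4 : 0 < complex.Re eps / 2 / 2 / 2 by rewrite !divr_gt0.
have [N h] := small _ e4; have dN := h _ (leqnn N).
have cN : OA_norm (cls (CSeq pc) - OA_of (p N)) <=
    (d N + d N) + (d N + d N).
  apply: (@OA_dist_le _ _ N) => n nN; apply: le_trans (ltW (pd n N)) _.
  by rewrite lerD2r lerD // dle.
apply: filterS (hp N) => x; rewrite -ball_normE /ball_ /= => xN.
rewrite -(subrKA (OA_of (p N))) -eE [complex.Re eps]splitr rmorphD.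
apply: le_lt_trans (ler_normD _ _) _; apply: ltrD.
  rewrite OA_normcE ltcR; apply: le_lt_trans cN _.
  by rewrite [ltRHS]splitr ltrD // [ltRHS]splitr ltrD.
apply: lt_trans xN _; rewrite ltcR [ltRHS]splitr ltrD //.
  apply: lt_trans dN _; rewrite [ltRHS]splitr ltr_pwDl // ltW //.
apply: lt_trans dN _; rewrite [ltRHS]splitr ltr_pwDl // ltW //.
Qed.

HB.instance Definition _ := Uniform_isComplete.Build OA OA_complete.

Lemma OA_mulA : associative OA_mul.
Proof.
move=> a b c; have [u ->] := cls_surj a; have [v ->] := cls_surj b.
have [w ->] := cls_surj c; rewrite !OA_mulE.
by apply: cls_ev => n pi x.
Qed.

Lemma OA_mulDl : left_distributive OA_mul +%R.
Proof.
move=> a b c; have [u ->] := cls_surj a; have [v ->] := cls_surj b.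
have [w ->] := cls_surj c; rewrite [_ + _ in LHS]OA_addE !OA_mulE.
by rewrite [RHS]OA_addE; apply: cls_ev => n pi x.
Qed.

Lemma OA_mulDr : right_distributive OA_mul +%R.
Proof.
move=> a b c; have [u ->] := cls_surj a; have [v ->] := cls_surj b.
have [w ->] := cls_surj c; rewrite [_ + _ in LHS]OA_addE !OA_mulE.
rewrite [RHS]OA_addE; apply: cls_ev => n pi x.
exact: (linearD (@ev pi (u n))).
Qed.

Lemma OA_mulZl (c : R[i]) (a b : OA) : OA_mul (c *: a) b = c *: OA_mul a b.
Proof.
have [u ->] := cls_surj a; have [v ->] := cls_surj b.
rewrite [_ *: _ in LHS]OA_scaleE !OA_mulE [RHS]OA_scaleE.
by apply: cls_ev => n pi x.
Qed.

Lemma OA_mulZr (c : R[i]) (a b : OA) : OA_mul a (c *: b) = c *: OA_mul a b.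
Proof.
have [u ->] := cls_surj a; have [v ->] := cls_surj b.
rewrite [_ *: _ in LHS]OA_scaleE !OA_mulE [RHS]OA_scaleE.
by apply: cls_ev => n pi x; rewrite /= linearZ.
Qed.

Lemma OA_normc_mul (a b : OA) : `|OA_mul a b| <= `|a| * `|b|.
Proof. by rewrite !OA_normcE -rmorphM lecR OA_norm_mul. Qed.

HB.instance Definition _ := CompleteNormedModule_isBanachAlgebra.Build R[i] OA
  OA_mulA OA_mulDl OA_mulDr OA_mulZl OA_mulZr OA_normc_mul.

End Representations.

(* Main.v *)
Require Import Defs.
From HB Require Import structures.
From mathcomp Require Import all_boot all_order all_algebra reals complex.
From mathcomp Require Import sesquilinear spectral ring.
From mathcomp Require Import boolp classical_sets topology normedtype.
From mathcomp Require Import sequences realfun trigo.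

(* A character of OA(Q) is given by the set S of vertices sent to 1 and, for
   each edge inside S, a point of the closed disc. If p is idempotent, the trace
   of its image is an integer, hence constant along continuous paths of
   finite-dimensional representations; contracting the edges to 0 and rotating
   lines in C^2, the value at p of a character supported on S is the sum over
   w in S of the values at p of the characters supported on {w}. Such values
   being 0 or 1, at most one w contributes. Applied to the images of the vertex
   projections, this shows that an isomorphism matches the characters supported
   on single vertices. The edges from v' to v are then counted by the bounded
   (chi_v, chi_v')-derivations modulo the multiples of chi_v - chi_v'. *)

Set Implicit Arguments.
Unset Strict Implicit.
Unset Printing Implicit Defensive.
Import Order.TTheory GRing.Theory Num.Theory.
Import numFieldNormedType.Exports.
Local Open Scope complex_scope.
Local Open Scope classical_set_scope.
Local Open Scope ring_scope.

(** * The Hilbert space C^n *)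

(** Projections of distinct vertices satisfy no relation with one another, which both helps and
    hinders. It is what lets lines in C^2 rotate freely. But for v different from v', the Leibniz
    rule applied to P_u = P_u P_u forces d(P_u) = 0 only when u is neither v nor v'. The numbers
    d(P_v) and d(P_v') stay free, and subtracting a multiple of chi_v - chi_v' removes one of these
    two parameters only. Boundedness removes the other: U = (2 P_v - 1)(2 P_v' - 1) acts as a
    unitary in every representation and both characters take the value -1 at it, so d(U^n) grows
    linearly in n unless d(P_v) + d(P_v') = 0. The isomorphism need not be isometric, and a
    character transported by it has unknown support and unknown values on the edges. Bounded
    characters are automatically contractive, so these values still lie in the closed disc and can
    be shrunk to 0 through contractive representations. *)

Definition ell2 (R : realType) (n : nat) : Type := 'rV[R[i]]_n.
(** Only the module structure of row vectors is transferred: the alias is to carry the Euclidean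
    norm and not the sup norm of matrices. *)
HB.instance Definition _ R n := GRing.Lmodule.on (ell2 R n).

Section Ell2.
Variables (R : realType) (n : nat).
Implicit Types u v : ell2 R n.

Definition ell2_dot u v : R[i] := dotmx u v.
HB.instance Definition _ := Bilinear.copy ell2_dot (@dotmx R[i] n).
HB.instance Definition _ := Hermitian.copy ell2_dot (@dotmx R[i] n).
HB.instance Definition _ := Dot.copy ell2_dot (@dotmx R[i] n).

Lemma ell2_dotE u v : ell2_dot u v = \sum_i u 0 i * (v 0 i)^*.
Proof.
by rewrite /ell2_dot dotmxE !mxE; apply: eq_bigr => i _; rewrite !mxE.
Qed.

Definition ell2_norm u : R[i] := sqrtC (ell2_dot u u).

Lemma ell2_normD u v : ell2_norm (u + v) <= ell2_norm u + ell2_norm v.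
Proof. by rewrite (triangle_lerif (@dotmx R[i] n)). Qed.

Lemma ell2_normZ (c : R[i]) u : ell2_norm (c *: u) = `|c| * ell2_norm u.
Proof.
rewrite /ell2_norm /ell2_dot dnormZ sqrtCM ?nnegrE ?exprn_ge0 ?dnorm_ge0 //.
by rewrite sqrCK.
Qed.

Lemma ell2_norm_eq0 u : ell2_norm u = 0 -> u = 0.
Proof.
by move/eqP; rewrite /ell2_norm /ell2_dot sqrt_dnorm_eq0 => /eqP.
Qed.

HB.instance Definition _ := Lmodule_isNormed.Build R[i] (ell2 R n)
  ell2_normD ell2_normZ ell2_norm_eq0.

Lemma ell2_sqr_norm u : `|u| ^+ 2 = \sum_i `|u 0 i| ^+ 2.
Proof.
rewrite [`|u|]/(ell2_norm u) sqrtCK ell2_dotE.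
by apply: eq_bigr => i _; rewrite normCK.
Qed.

Lemma ell2_coord_le u i : `|u 0 i| <= `|u|.
Proof.
rewrite -(@ler_pXn2r _ 2) ?nnegrE // ell2_sqr_norm (bigD1 i) //= lerDl.
by apply: sumr_ge0 => j _; rewrite exprn_ge0.
Qed.

Lemma ell2_norm_le_sum u : `|u| <= \sum_i `|u 0 i|.
Proof.
have S0 (P : pred 'I_n) : 0 <= \sum_(i | P i) `|u 0 i| by apply: sumr_ge0.
rewrite -(@ler_pXn2r _ 2) ?nnegrE ?ell2_sqr_norm //.
rewrite [in leRHS]expr2 mulr_suml; apply: ler_sum => i _.
rewrite expr2 ler_wpM2l // (bigD1 i) //= lerDl; exact: S0.
Qed.

End Ell2.

Section Ell2Complete.
Variables (R : realType) (n : nat).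

Lemma normc_le_ReIm (z : R[i]) :
  `|z| <= (`|complex.Re z| + `|complex.Im z|)%:C.
Proof.
rewrite normc_def lecR -[leRHS]ger0_norm ?addr_ge0 // -sqrtr_sqr.
rewrite ler_wsqrtr // sqrrD !real_normK ?num_real // -addrA lerD2l lerDr.
by rewrite mulrn_wge0 ?mulr_ge0.
Qed.

Lemma normc_ge_Im (z : R[i]) : `|complex.Im z|%:C <= `|z|.
Proof.
by rewrite normc_def lecR -sqrtr_sqr ler_wsqrtr // lerDr sqr_ge0.
Qed.

(** Reduces to the completeness of [R]: the real and imaginary parts of each coordinate, indexed by
    ['I_n * bool], are dominated by the norm and hence Cauchy. *)
Lemma ell2_complete (F : set_system (ell2 R n)) :
  ProperFilter F -> cauchy F -> cvg F.
Proof.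
move=> FF /cauchyP Fc.
pose part (b : bool) (z : R[i]) : R := if b then complex.Im z else complex.Re z.
have partB b z w : part b z - part b w = part b (z - w).
  by case: b; case: z => ? ?; case: w.
have part_le b z : (`|part b z|)%:C <= `|z|.
  by case: b; [exact: normc_ge_Im | exact: normc_ge_Re].
have /choice [l hl] (ib : 'I_n * bool) :
    exists l : R, part ib.2 ((u : ell2 R n) 0 ib.1) @[u --> F] --> l.
  apply/cvg_ex/cauchy_cvgP/cauchyP => e e0.
  have eC : 0 < e%:C :> R[i] by rewrite ltcR.
  have [u Fu] := Fc _ eC; exists (part ib.2 (u 0 ib.1)).
  suff : F [set v : ell2 R n |
    ball (part ib.2 (u 0 ib.1)) e (part ib.2 (v 0 ib.1))] by [].
  apply: filterS Fu => v; rewrite -!ball_normE /ball_ /= => uv.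
  rewrite -ltcR; apply: le_lt_trans uv; rewrite partB.
  apply: le_trans (part_le _ _) _.
  by have := ell2_coord_le (u - v) ib.1; rewrite !mxE.
pose u0 : ell2 R n := \row_i (l (i, false) +i* l (i, true)).
apply/cvg_ex; exists u0; apply/cvgrPdist_lt => eps e0.
have eE : (complex.Re eps)%:C = eps by apply: RRe_real; exact: gtr0_real.
have e1 : 0 < complex.Re eps by rewrite -ltcR eE.
(* Each of the [n] coordinates contributes at most [d + d]; dividing by [n.+1] makes the total
   strictly smaller than [eps], also for [n = 0]. *)
pose d := complex.Re eps / n.+1%:R / 2.
have d0 : 0 < d by rewrite !divr_gt0 // ltr0n.
have near_u0 : \forall u \near F, forall ib : 'I_n * bool,
    `|l ib - part ib.2 ((u : ell2 R n) 0 ib.1)| < d.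
  by apply: filter_forall => ib; have /cvgrPdist_lt := hl ib; apply.
apply: filterS near_u0 => u hu; apply: le_lt_trans (ell2_norm_le_sum _) _.
apply: (@le_lt_trans _ _ (\sum_(i < n) (d + d)%:C)).
  apply: ler_sum => i _; apply: le_trans (normc_le_ReIm _) _.
  rewrite lecR !mxE; have := hu (i, false); have := hu (i, true) => /=.
  by case: (u 0 i) => a b /= /ltW hb /ltW ha; exact: lerD.
rewrite sumr_const card_ord -eE -raddfMn /= ltcR.
rewrite -splitr; set e' := _ / _.
have e'0 : 0 < e' by rewrite divr_gt0 // ltr0n.
have -> : complex.Re eps = e' *+ n.+1.
  by rewrite /e' -[RHS]mulr_natr divfK // pnatr_eq0.
by rewrite mulrS ltrDr.
Qed.

HB.instance Definition _ :=
  Uniform_isComplete.Build (ell2 R n) ell2_complete.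

Lemma ell2_dot_norm (u : ell2 R n) : ell2_dot u u = `|u| ^+ 2.
Proof. by rewrite [`|u|]/(ell2_norm u) sqrtCK. Qed.

Definition ell2_hilbert : hilbert R := Hilbert ell2_dot_norm.

End Ell2Complete.

(** * Extension of contractive representations to OA(Q) *)

Lemma normcR (R : rcfType) (r : R) : `|r%:C| = `|r|%:C.
Proof. by rewrite normc_def /= expr0n /= addr0 sqrtr_sqr. Qed.

Lemma cvg_Re_norm (R : realType) (V : normedModType R[i]) (T : Type)
    (F : set_system T) (FF : Filter F) (f : T -> V) (y : V) :
  f @ F --> y -> complex.Re `|f t| @[t --> F] --> complex.Re `|y|.
Proof.
move=> fy; apply/cvgrPdist_le => e e0.
have eC : 0 < e%:C :> R[i] by rewrite ltcR.
have /cvgrPdist_le /(_ _ eC) := fy; apply: filterS => t yt.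
rewrite -lecR; apply: le_trans yt; apply: le_trans (ler_dist_dist _ _).
rewrite -(normC_Re y) -(normC_Re (f t)).
by rewrite -rmorphB normcR.
Qed.

Section Extension.
Variables (R : realType) (Q : fin_digraph) (pi : crep R Q).
Implicit Types (a b : OA R Q) (u : cseq R Q) (p : term R Q) (x : rep_sp pi).

Lemma is_cvg_ev u x : cvgn (fun n => ev (u n) x).
Proof.
apply/cauchy_cvgP/cauchyP => eps e0.
have eE : (complex.Re eps)%:C = eps by apply: RRe_real; exact: gtr0_real.
have e1 : 0 < complex.Re eps by rewrite -ltcR eE.
have x1 : 0 < complex.Re `|x| + 1 by rewrite ltr_wpDl ?Re_norm_ge0.
have [N h] := cseqP u (divr_gt0 e1 x1).
exists (ev (u N) x); exists N => // n /= Nn.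
rewrite -ball_normE /ball_ /= -ev_sub; apply: le_lt_trans (ev_le _ _) _.
rewrite -normC_Re -rmorphM -eE ltcR.
have := h _ _ (leqnn N) Nn; rewrite ltr_pdivlMr //; apply: le_lt_trans.
by rewrite ler_wpM2l ?unorm_ge0 // lerDl.
Qed.

Definition ext a x : rep_sp pi := limn (fun n => ev (repr a n) x).

(** Independence of the representative: [u] and the chosen one differ by a null sequence for
    [unorm], which dominates the norm in [pi]. *)
Lemma cvg_ext u x : ev (u n) x @[n --> \oo] --> ext (cls u) x.
Proof.
set v := repr (cls u).
have -> : (fun n => ev (u n) x) =
    (fun n => ev (v n) x + (ev (u n) x - ev (v n) x)).
  by apply/funext => n; rewrite addrC subrK.
rewrite -[ext _ _]addr0; apply: cvgD; first exact: is_cvg_ev.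
apply/cvgrPdist_lt => eps e0.
have eE : (complex.Re eps)%:C = eps by apply: RRe_real; exact: gtr0_real.
have e1 : 0 < complex.Re eps by rewrite -ltcR eE.
have x1 : 0 < complex.Re `|x| + 1 by rewrite ltr_wpDl ?Re_norm_ge0.
have /ceqP /(_ _ (divr_gt0 e1 x1)) [N h] := ceq_repr u.
exists N => // n /= Nn; rewrite sub0r normrN distrC -ev_sub.
apply: le_lt_trans (ev_le _ _) _.
rewrite -normC_Re -rmorphM -eE ltcR.
have := h _ Nn; rewrite ltr_pdivlMr //; apply: le_lt_trans.
by rewrite ler_wpM2l ?unorm_ge0 // lerDl.
Qed.

Lemma ext_lim u x y : ev (u n) x @[n --> \oo] --> y -> ext (cls u) x = y.
Proof.
move=> uy; rewrite -(cvg_lim _ (@cvg_ext u x)); first exact: cvg_lim uy.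
exact: norm_hausdorff.
Qed.

Lemma ext_of p x : ext (OA_of p) x = ev p x.
Proof. by apply: ext_lim; exact: cvg_cst. Qed.

Lemma extD a b x : ext (a + b) x = ext a x + ext b x.
Proof.
have [u ->] := cls_surj a; have [v ->] := cls_surj b.
rewrite [_ + _ in LHS]OA_addE; apply: ext_lim.
by apply: cvgD; exact: cvg_ext.
Qed.

Lemma extZ (c : R[i]) a x : ext (c *: a) x = c *: ext a x.
Proof.
have [u ->] := cls_surj a.
rewrite [_ *: _ in LHS]OA_scaleE; apply: ext_lim.
by apply: cvgZl_tmp; exact: cvg_ext.
Qed.

Lemma ext_linear a : linear (ext a).
Proof.
move=> c x y; have [u ->] := cls_surj a; apply: ext_lim.
have -> : (fun n => ev (u n) (c *: x + y)) =
    (fun n => c *: ev (u n) x + ev (u n) y).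
  by apply/funext => n; rewrite linearP.
by apply: cvgD; [apply: cvgZl_tmp|]; exact: cvg_ext.
Qed.

HB.instance Definition _ a := GRing.isLinear.Build R[i]
  (rep_sp pi) (rep_sp pi) *:%R (ext a) (@ext_linear a).

Lemma ext_norm a x : `|ext a x| <= `|a| * `|x|.
Proof.
have [u ->] := cls_surj a.
rewrite OA_normcE OA_normE -[leLHS]normC_Re -[`|x|]normC_Re -rmorphM lecR.
have cvl :
    complex.Re `|ev (u n) x| @[n --> \oo] --> complex.Re `|ext (cls u) x|.
  by apply: cvg_Re_norm; exact: cvg_ext.
have cvr : unorm (u n) * complex.Re `|x| @[n --> \oo] -->
    limn (fun n => unorm (u n)) * complex.Re `|x|.
  by apply: cvgM; [exact: is_cvg_unorm|exact: cvg_cst].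
rewrite -(cvg_lim _ cvl) // -(cvg_lim _ cvr) //.
apply: ler_lim; [by apply/cvg_ex; eexists; exact: cvl
                |by apply/cvg_ex; eexists; exact: cvr|].
apply: nearW => n; rewrite -lecR rmorphM /= !normC_Re; exact: ev_le.
Qed.

Lemma extM a b x : ext (bmul a b) x = ext a (ext b x).
Proof.
have [u ->] := cls_surj a; have [v ->] := cls_surj b.
rewrite [bmul _ _]OA_mulE; apply: ext_lim.
set y := ext (cls v) x.
(* The error [ev (v n) x - y] tends to 0, and the operators [ev (u n)] applied to it are eventually
   uniformly bounded. *)
have -> : (fun n => ev (cmul u v n) x) =
    (fun n => ev (u n) y + ev (u n) (ev (v n) x - y)).
  by apply/funext => n; rewrite /= linearB /= addrC subrK.
rewrite -[ext _ y]addr0; apply: cvgD; first exact: cvg_ext.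
have [M M0 [N hN]] := cseq_bounded u.
apply/cvgrPdist_lt => eps e0.
have MC : 0 < M%:C :> R[i] by rewrite ltcR.
have /cvgrPdist_lt /(_ _ (divr_gt0 e0 MC)) := @cvg_ext v x.
move=> [N' _ hN']; exists (maxn N N') => // n /=; rewrite geq_max => /andP[Nn Nn'].
rewrite sub0r normrN; apply: le_lt_trans (ev_le _ _) _.
have := hN' _ Nn'; rewrite ltr_pdivlMr // distrC mulrC; apply: le_lt_trans.
by rewrite ler_wpM2r // lecR hN.
Qed.

End Extension.

(** * Generators of OA(Q) and bounded linear maps *)

Section Functionals.
Variables (R : realType) (Q : fin_digraph).
Local Notation A := (OA R Q).

Lemma OA_of0 : OA_of (TZero R Q) = 0.
Proof. by []. Qed.

Lemma OA_ofD (p q : term R Q) : OA_of (TAdd p q) = OA_of p + OA_of q.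
Proof. by rewrite [RHS]OA_addE; apply: cls_ev. Qed.

Lemma OA_ofZ (c : R[i]) (p : term R Q) : OA_of (TScale c p) = c *: OA_of p.
Proof. by rewrite [RHS]OA_scaleE; apply: cls_ev. Qed.

Lemma OA_ofM (p q : term R Q) : OA_of (TMul p q) = bmul (OA_of p) (OA_of q).
Proof. by rewrite [RHS]OA_mulE; apply: cls_ev. Qed.

Definition Pv v : A := OA_of (TVert R v).
Definition Te e : A := OA_of (TEdge R e).

Lemma Pv_idem v : bmul (Pv v) (Pv v) = Pv v.
Proof.
rewrite -OA_ofM; apply: cls_ev => n pi x /=.
by have [-> _] := rep_v_proj pi v.
Qed.

Lemma Te_rng e : bmul (Pv (rng e)) (Te e) = Te e.
Proof. by rewrite -OA_ofM; apply: cls_ev => n pi x /=; rewrite rep_rng. Qed.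

Lemma Te_src e : bmul (Te e) (Pv (src e)) = Te e.
Proof. by rewrite -OA_ofM; apply: cls_ev => n pi x /=; rewrite rep_src. Qed.

Lemma norm_OA_of_le (p : term R Q) (M : R) : 0 <= M ->
  (forall pi x, `|@ev R Q pi p x| <= M%:C * `|x|) -> `|OA_of p| <= M%:C.
Proof. by move=> M0 h; rewrite OA_normcE lecR OA_norm_of unorm_le. Qed.

(** The constant in [bounded_op] is complex. A nonzero vector forces it to be real and nonnegative;
    over the zero space it is arbitrary, whence the passage to its modulus. *)
Lemma bounded_op_ge0 (V W : normedModType R[i]) (f : V -> W) : bounded_op f ->
  exists2 M : R, 0 <= M & forall x, `|f x| <= M%:C * `|x|.
Proof.
move=> [M fM]; exists (complex.Re `|M|) => [|x]; first exact: Re_normc_ge0.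
apply: le_trans (fM x) _; rewrite Re_normcE.
have [->|x0] := eqVneq x 0; first by rewrite normr0 !mulr0.
have nx : 0 < `|x| by rewrite normr_gt0.
rewrite ler_pM2r //; apply: real_ler_norm.
have M0 : 0 <= M by rewrite -(pmulr_lge0 _ nx) (le_trans _ (fM x)).
exact: ger0_real.
Qed.

Lemma bounded_op_comp (U V W : normedModType R[i]) (f : V -> W) (g : U -> V) :
  bounded_op f -> bounded_op g -> bounded_op (f \o g).
Proof.
move=> /bounded_op_ge0 [M M0 fM] /bounded_op_ge0 [N N0 gN].
exists (M%:C * N%:C) => x; apply: le_trans (fM _) _.
by rewrite -mulrA ler_wpM2l ?ler0c.
Qed.

(** Density of the terms. Identities between bounded maps on OA(Q) are reduced by this lemma to
    inductions on terms, hence to vertices and edges. *)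
Lemma eq0_on_terms (V : normedModType R[i]) (f : {linear A -> V}) :
  bounded_op f -> (forall p, f (OA_of p) = 0) -> forall a, f a = 0.
Proof.
move=> /bounded_op_ge0 [M M0 fM] f0 a; apply/eqP; rewrite -normr_eq0.
suff small (e : R) : 0 < e -> complex.Re `|f a| <= e.
  rewrite -normC_Re fmorph_eq0 eq_le Re_norm_ge0 andbT.
  by apply/ler_addgt0Pl => e /small; rewrite addr0.
move=> e0; have M1 : 0 < M + 1 by rewrite ltr_wpDl.
have [p hp] := OA_dense a (divr_gt0 e0 M1).
rewrite -lecR normC_Re -[f a]subr0 -(f0 p) -linearB; apply: le_trans (fM _) _.
rewrite OA_normcE -rmorphM lecR; move: hp; rewrite ler_pdivlMr //.
apply: le_trans; rewrite mulrC ler_wpM2l ?lerDl //.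
by rewrite -lecR -OA_normcE normr_ge0.
Qed.

End Functionals.

(** * Characters *)

Section Characters.
Variables (R : realType).

Lemma bernoulli_le (r : R) n : 0 <= r -> 1 + r *+ n <= (1 + r) ^+ n.
Proof.
move=> r0; elim: n => [|n IH]; first by rewrite mulr0n addr0 expr0.
rewrite exprS; apply: le_trans (_ : (1 + r) * (1 + r *+ n) <= _); last first.
  by rewrite ler_wpM2l // addr_ge0.
rewrite mulrDl mul1r mulrDr mulr1 addrA -addrA -addrA lerD2l mulrSr lerD2l.
by rewrite lerDl mulr_ge0 ?mulrn_wge0.
Qed.

Lemma geometric_unbounded (r M : R) : 1 < r -> exists n, M < r ^+ n.
Proof.
move=> r1; have s0 : 0 < r - 1 by rewrite subr_gt0.
exists (Num.truncn (M / (r - 1))).+1.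
apply: lt_le_trans (_ : 1 + (r - 1) *+ (Num.truncn (M / (r - 1))).+1 <= _).
  by rewrite -mulr_natl ltr_wpDl // -ltr_pdivrMr // truncnS_gt.
have := bernoulli_le (Num.truncn (M / (r - 1))).+1 (ltW s0).
by rewrite (addrC 1 (r - 1)) subrK.
Qed.

(* Powers give [|chi a|^n <= M |a|^n], and n-th roots remove the constant. *)
Lemma mult_functional_contr (A : banachAlgType R[i])
    (chi : {linear A -> R[i]^o}) : bounded_op chi ->
  (forall a b, chi (bmul a b) = chi a * chi b) -> forall a, `|chi a| <= `|a|.
Proof.
move=> /bounded_op_ge0 [M M0 chiM] chi_mul a.
have pw n : `|chi a| ^+ n.+1 <= M%:C * `|a| ^+ n.+1.
  have [b [chib bn]] : exists b, chi b = chi a ^+ n.+1 /\ `|b| <= `|a| ^+ n.+1.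
    elim: n => [|n [b [chib bn]]]; first by exists a.
    exists (bmul a b); rewrite chi_mul chib -exprS; split=> //.
    by rewrite (exprS `|a|) (le_trans (norm_bmul _ _)) // ler_wpM2l.
  by rewrite -normrX -chib; apply: le_trans (chiM _) _; rewrite ler_wpM2l ?ler0c.
have {pw} pw n : complex.Re `|chi a| ^+ n.+1 <= M * complex.Re `|a| ^+ n.+1.
  have := pw n; rewrite -(normC_Re (chi a)) -(normC_Re a) -!rmorphXn -rmorphM /=.
  by rewrite lecR.
rewrite -normC_Re -[leRHS]normC_Re lecR leNgt; apply/negP => lt.
have [a0|a0] := eqVneq (complex.Re `|a|) 0.
  by have := pw 0; rewrite a0 !expr1 mulr0 leNgt -a0 lt.
have ap : 0 < complex.Re `|a| by rewrite lt_def a0 Re_norm_ge0.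
have r1 : 1 < complex.Re `|chi a| / complex.Re `|a| by rewrite ltr_pdivlMr ?mul1r.
have [n] := geometric_unbounded M r1.
apply/negP; rewrite -leNgt.
apply: le_trans (_ : (complex.Re `|chi a| / complex.Re `|a|) ^+ n.+1 <= _).
  by rewrite exprS ler_peMl ?exprn_ge0 ?(le_trans ler01) ?ltW.
by rewrite expr_div_n ler_pdivrMr ?exprn_gt0.
Qed.

Variable Q : fin_digraph.
Local Notation A := (OA R Q).

Lemma mult_functional_eq (chi psi : {linear A -> R[i]^o}) :
  bounded_op chi -> bounded_op psi ->
  (forall a b, chi (bmul a b) = chi a * chi b) ->
  (forall a b, psi (bmul a b) = psi a * psi b) ->
  (forall v, chi (Pv R v) = psi (Pv R v)) ->
  (forall e, chi (Te R e) = psi (Te R e)) -> forall a, chi a = psi a.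
Proof.
move=> [M chiM] [N psiN] chi_mul psi_mul eqv eqe a; apply/eqP.
rewrite -subr_eq0; apply/eqP; pose f : {linear A -> R[i]^o} := chi \- psi.
apply: (@eq0_on_terms _ _ _ f) => [|p].
  exists (M + N) => b /=; apply: le_trans (ler_normB _ _) _.
  by rewrite mulrDl lerD.
apply/eqP; rewrite subr_eq0; apply/eqP.
elim: p => [|v|e|p IHp q IHq|c p IHp|p IHp q IHq].
- by rewrite OA_of0 !linear0.
- exact: eqv.
- exact: eqe.
- by rewrite OA_ofD !linearD IHp IHq.
- by rewrite OA_ofZ !linearZ IHp.
- by rewrite OA_ofM chi_mul psi_mul IHp IHq.
Qed.

Lemma idempotent_scalar (c : R[i]) : c * c = c -> c = (c != 0)%:R.
Proof.
have [->//|c0] := eqVneq c 0; rewrite -{3}[c]mulr1.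
by move/(mulfI c0).
Qed.

Lemma mult_functional_Pv (chi : {linear A -> R[i]^o}) v :
  (forall a b, chi (bmul a b) = chi a * chi b) ->
  chi (Pv R v) = (chi (Pv R v) != 0)%:R.
Proof.
by move=> chi_mul; apply: idempotent_scalar; rewrite -chi_mul Pv_idem.
Qed.

(** Both sides are bounded and linear in [a], so an induction on terms suffices. This recognises a
    character inside a representation from a joint eigenvector of the generators. *)
Lemma ext_eigen (pi : crep R Q) (x : rep_sp pi) (chi : {linear A -> R[i]^o}) :
  bounded_op chi -> (forall a b, chi (bmul a b) = chi a * chi b) ->
  (forall v, rep_v pi v x = chi (Pv R v) *: x) ->
  (forall e, rep_e pi e x = chi (Te R e) *: x) ->
  forall a, ext a x = chi a *: x.
Proof.
move=> [M chiM] chi_mul hv he a.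
have lf : linear (fun a => ext a x - chi a *: x).
  move=> c b d; rewrite extD extZ linearP scalerDl scalerBr opprD addrACA.
  by rewrite -scalerA.
pose f : {linear A -> rep_sp pi} :=
  HB.pack (fun a => ext a x - chi a *: x) (GRing.isLinear.Build _ _ _ _ _ lf).
apply/eqP; rewrite -subr_eq0; apply/eqP.
apply: (@eq0_on_terms _ _ _ f) => [|p].
  exists (`|x| + M * `|x|) => b /=; apply: le_trans (ler_normB _ _) _.
  rewrite mulrDl lerD ?normrZ //; first by rewrite mulrC ext_norm.
  by rewrite mulrAC ler_wpM2r.
apply/eqP; rewrite subr_eq0 /= ext_of; apply/eqP.
elim: p => [|v|e|p IHp q IHq|c p IHp|p IHp q IHq] /=.
- by rewrite OA_of0 linear0 scale0r.
- exact: hv.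
- exact: he.
- by rewrite OA_ofD linearD scalerDl IHp IHq.
- by rewrite OA_ofZ linearZ IHp scalerA.
- by rewrite OA_ofM chi_mul IHq linearZ /= IHp scalerA mulrC.
Qed.

End Characters.

(** * Paths of matrix representations *)

Section MatrixReps.
Variables (R : realType) (Q : fin_digraph) (n : nat).
Local Notation A := (OA R Q).
Local Notation C := R[i].

Definition ell2_mul (M : 'M[C]_n) (u : ell2_hilbert R n) : ell2_hilbert R n :=
  (u : 'rV[C]_n) *m M.

Lemma ell2_mul_linear M : linear (ell2_mul M).
Proof. by move=> c u v; rewrite /ell2_mul mulmxDl -scalemxAl. Qed.

HB.instance Definition _ M := GRing.isLinear.Build C
  (ell2_hilbert R n) (ell2_hilbert R n) *:%R (ell2_mul M) (@ell2_mul_linear M).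

(* Matrices act on row vectors from the right. *)
Record matrix_rep := MatrixRep {
  mx_v : vert Q -> 'M[C]_n;
  mx_e : edge Q -> 'M[C]_n;
  mx_v_proj : forall v, projection (ell2_mul (mx_v v));
  mx_e_contr : forall e, Defs.contraction (ell2_mul (mx_e e));
  mx_rng : forall e, mx_e e *m mx_v (rng e) = mx_e e;
  mx_src : forall e, mx_v (src e) *m mx_e e = mx_e e }.

Variable m : matrix_rep.

Lemma matrix_rep_rng e x :
  ell2_mul (mx_v m (rng e)) (ell2_mul (mx_e m e) x) = ell2_mul (mx_e m e) x.
Proof. by rewrite /ell2_mul -mulmxA mx_rng. Qed.

Lemma matrix_rep_src e x :
  ell2_mul (mx_e m e) (ell2_mul (mx_v m (src e)) x) = ell2_mul (mx_e m e) x.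
Proof. by rewrite /ell2_mul -mulmxA mx_src. Qed.

Definition crep_of : crep R Q := @CRep R Q (ell2_hilbert R n)
  (fun v => ell2_mul (mx_v m v)) (fun e => ell2_mul (mx_e m e))
  (mx_v_proj m) (mx_e_contr m) matrix_rep_rng matrix_rep_src.

Fixpoint mx_ev (p : term R Q) : 'M[C]_n :=
  match p with
  | TZero => 0
  | TVert v => mx_v m v
  | TEdge e => mx_e m e
  | TAdd p q => mx_ev p + mx_ev q
  | TScale c p => c *: mx_ev p
  | TMul p q => mx_ev q *m mx_ev p
  end.

Lemma ev_crep_of p (x : rep_sp crep_of) :
  ev p x = ((x : 'rV[C]_n) *m mx_ev p : ell2_hilbert R n).
Proof.
elim: p x => //= [|p IHp q IHq|c p IHp|p IHp q IHq] x.
- by rewrite mulmx0.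
- by rewrite mulmxDr IHp IHq.
- by rewrite -scalemxAr IHp.
- by rewrite mulmxA IHp IHq.
Qed.

Definition mx_ext (a : A) : 'M[C]_n :=
  lin1_mx (fun u : 'rV_n => ext a (u : rep_sp crep_of) : 'rV_n).

Lemma mul_mx_ext (a : A) (u : 'rV_n) :
  u *m mx_ext a = ext a (u : rep_sp crep_of).
Proof.
pose f : {linear 'rV[C]_n -> 'rV[C]_n} :=
  HB.pack (fun u : 'rV_n => ext a (u : rep_sp crep_of) : 'rV_n)
   (GRing.isLinear.Build C 'rV_n 'rV_n *:%R _ (@ext_linear _ _ crep_of a)).
exact: (mul_rV_lin1 f).
Qed.

Lemma mx_extM (a b : A) : mx_ext (bmul a b) = mx_ext b *m mx_ext a.
Proof.
by apply/row_matrixP => i; rewrite !rowE mulmxA !mul_mx_ext extM.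
Qed.

Lemma mx_ext_entry (a : A) i j :
  mx_ext a i j = (ext a (delta_mx 0 i : rep_sp crep_of) : 'rV_n) 0 j.
Proof. by rewrite -mul_mx_ext -rowE [RHS]mxE. Qed.

Lemma ell2_norm_delta (i : 'I_n) : `|delta_mx 0 i : ell2 R n| = 1.
Proof.
apply/eqP; rewrite -(@eqrXn2 _ 2) // expr1n ell2_sqr_norm.
rewrite (bigD1 i) //= mxE !eqxx normr1 expr1n big1 ?addr0 // => j ji.
by rewrite mxE (negbTE ji) andbF normr0 expr0n.
Qed.

(** The bound is the same for all representations [m], so approximation of [a] by a term is uniform
    along a path of representations. *)
Lemma mx_ext_of_dist (a : A) p i j :
  `|mx_ext a i j - mx_ev p i j| <= `|a - OA_of p|.
Proof.
have -> : mx_ext a i j - mx_ev p i j =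
    (ext (a - OA_of p) (delta_mx 0 i : rep_sp crep_of) : 'rV_n) 0 j.
  rewrite mx_ext_entry -(scaleN1r (OA_of p)) extD extZ ext_of scaleN1r.
  by rewrite ev_crep_of -rowE !mxE.
apply: le_trans (ell2_coord_le _ _) _.
have := ext_norm (a - OA_of p) (delta_mx 0 i : rep_sp crep_of).
have -> : `|delta_mx 0 i : rep_sp crep_of| = 1 by exact: ell2_norm_delta.
by rewrite mulr1.
Qed.

Lemma mx_ext_of p : mx_ext (OA_of p) = mx_ev p.
Proof.
apply/matrixP => i j; apply/eqP.
rewrite -subr_eq0 -normr_eq0 eq_le normr_ge0 andbT.
by have := mx_ext_of_dist (OA_of p) p i j; rewrite subrr normr0.
Qed.

(** The standard basis vectors are joint eigenvectors. It evaluates the trace at the two ends of a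
    path. *)
Lemma mx_ext_tr_diag (chi : 'I_n -> {linear A -> C^o}) :
  (forall i, bounded_op (chi i)) ->
  (forall i a b, chi i (bmul a b) = chi i a * chi i b) ->
  (forall v, mx_v m v = diag_mx (\row_i chi i (Pv R v))) ->
  (forall e, mx_e m e = diag_mx (\row_i chi i (Te R e))) ->
  forall a, \tr (mx_ext a) = \sum_i chi i a.
Proof.
move=> chi_bd chi_mul hv he a; apply: eq_bigr => i _.
rewrite mx_ext_entry (@ext_eigen _ _ _ _ (chi i)) //.
- by rewrite !mxE !eqxx mulr1.
- move=> v /=; rewrite /ell2_mul hv -rowE; apply/rowP => j.
  rewrite !mxE eqxx /= (eq_sym j) mulrb.
  by case: eqVneq => [->|]; rewrite ?mulr1 ?mulr0.
- move=> e /=; rewrite /ell2_mul he -rowE; apply/rowP => j.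
  rewrite !mxE eqxx /= (eq_sym j) mulrb.
  by case: eqVneq => [->|]; rewrite ?mulr1 ?mulr0.
Qed.

End MatrixReps.

(** In a full-rank factorization M = CB of an idempotent, cancelling C on the left and B on the
    right of CBCB = CB gives BC = 1; the trace of CB is that of BC. *)
Lemma tr_idempotent (F : fieldType) n (M : 'M[F]_n) :
  M *m M = M -> \tr M = (\rank M)%:R.
Proof.
move=> MM; rewrite -{1}(mulmx_base M) mxtrace_mulC.
suff -> : row_base M *m col_base M = 1%:M by rewrite mxtrace1.
apply: (row_full_inj (col_base_full M)); apply: (row_free_inj (row_base_free M)).
by rewrite /= mulmx1 mulmx_base mulmxA -[LHS]mulmxA mulmx_base.
Qed.

Section Paths.
Variable R : realType.
Local Notation C := R[i].

(** Continuity is expressed through real and imaginary parts so that limits and the intermediate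
    value theorem are used for real functions. *)
Definition ccontinuous (f : R -> C) :=
  continuous (fun t => complex.Re (f t)) /\ continuous (fun t => complex.Im (f t)).

Lemma ccontinuous_cst c : ccontinuous (fun=> c).
Proof. by split=> t; exact: cvg_cst. Qed.

Lemma ccontinuous_real (f : R -> R) :
  continuous f -> ccontinuous (fun t => (f t)%:C).
Proof. by move=> fc; split=> t; [exact: fc|exact: cvg_cst]. Qed.

Lemma ccontinuousD (f g : R -> C) :
  ccontinuous f -> ccontinuous g -> ccontinuous (fun t => f t + g t).
Proof.
move=> [f1 f2] [g1 g2]; split=> t.
  under eq_fun do rewrite raddfD /=.
  by apply: cvgD; [exact: f1|exact: g1].
under eq_fun do rewrite raddfD /=.
by apply: cvgD; [exact: f2|exact: g2].
Qed.

Lemma ccontinuousM (f g : R -> C) :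
  ccontinuous f -> ccontinuous g -> ccontinuous (fun t => f t * g t).
Proof.
move=> [f1 f2] [g1 g2]; split=> t.
  have -> : (fun t => complex.Re (f t * g t)) = (fun t =>
      complex.Re (f t) * complex.Re (g t) - complex.Im (f t) * complex.Im (g t)).
    by apply/funext => s; case: (f s) (g s) => ? ? [].
  by apply: cvgB; apply: cvgM; solve [exact: f1|exact: g1|exact: f2|exact: g2].
have -> : (fun t => complex.Im (f t * g t)) = (fun t =>
    complex.Re (f t) * complex.Im (g t) + complex.Im (f t) * complex.Re (g t)).
  by apply/funext => s; case: (f s) (g s) => ? ? [].
by apply: cvgD; apply: cvgM; solve [exact: f1|exact: g1|exact: f2|exact: g2].
Qed.

Lemma ccontinuous_sum (I : Type) (r : seq I) (f : I -> R -> C) :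
  (forall i, ccontinuous (f i)) -> ccontinuous (fun t => \sum_(i <- r) f i t).
Proof.
move=> fc; elim: r => [|i r IH].
  by under eq_fun do rewrite big_nil; exact: ccontinuous_cst.
by under eq_fun do rewrite big_cons; exact: ccontinuousD.
Qed.

Lemma continuous_nat_constant (f : R -> R) :
  continuous f -> (forall t, exists k, f t = k%:R) -> forall s t, f s = f t.
Proof.
move=> fc fn; suff main s t : s <= t -> f s = f t.
  by move=> s t; have [/main //|/ltW /main ->] := leP s t.
move=> st; apply/eqP; apply/negPn/negP => fst.
have [[k fk] [l fl]] := (fn s, fn t); rewrite fk fl eqr_nat in fst.
(* Two different natural values enclose a half-integer, which would also be a value; doubling it
   equates an even number with an odd one. *)
have [c _] : exists2 c, c \in `[s, t] & f c = (minn k l)%:R + 2^-1.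
  apply: IVT => //; first exact: continuous_subspaceT.
  rewrite fk fl; wlog kl : k l {fk fl} fst / (k < l)%N.
    move=> H; move: (fst); rewrite neq_ltn => /orP[/(H _ _ fst) //|lk].
    by rewrite minC maxC minnC; apply: H; rewrite // eq_sym.
  rewrite minElt maxElt ltr_nat kl (minn_idPl (ltnW kl)) lerDl invr_ge0 ler0n /=.
  apply: le_trans (_ : k.+1%:R <= _); last by rewrite ler_nat.
  by rewrite -[k.+1%:R]natr1 lerD2l invf_le1 ?ler1n.
have [j ->] := fn c; move=> /(congr1 ( *%R 2)).
rewrite mulrDr mulfV ?pnatr_eq0 // -!natrM natr1 => /eqP.
by rewrite eqr_nat => /eqP /(congr1 odd); rewrite /= !oddM.
Qed.

Variables (Q : fin_digraph) (n : nat) (m : R -> matrix_rep R Q n).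
Hypothesis m_v_cont : forall v i j, ccontinuous (fun t => mx_v (m t) v i j).
Hypothesis m_e_cont : forall e i j, ccontinuous (fun t => mx_e (m t) e i j).

Lemma mx_ev_continuous p i j : ccontinuous (fun t => mx_ev (m t) p i j).
Proof.
elim: p i j => /= [|//|//|p IHp q IHq|c p IHp|p IHp q IHq] i j.
- by under eq_fun do rewrite mxE; exact: ccontinuous_cst.
- by under eq_fun do rewrite mxE; exact: ccontinuousD.
- under eq_fun do rewrite mxE; apply: ccontinuousM => //.
  exact: ccontinuous_cst.
- under eq_fun do rewrite mxE; apply: ccontinuous_sum => k.
  exact: ccontinuousM.
Qed.

(** A uniform limit of continuous functions: the matrix of a term is continuous in [t], and a term
    close to [a] approximates the trace uniformly in [t]. *)
Lemma tr_mx_ext_continuous (a : OA R Q) :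
  continuous (fun t => complex.Re (\tr (mx_ext (m t) a))).
Proof.
have subE (X Y : 'M[C]_n) i : (X - Y) i i = X i i - Y i i by rewrite !mxE.
move=> t; apply/cvgrPdist_le => e e0.
(* The trace adds up [n] errors of size [d]; [n.+1] keeps [d] positive when [n = 0]. *)
pose d := e / 3 / n.+1%:R; have d0 : 0 < d by rewrite !divr_gt0 // ltr0n.
have [p hp] := OA_dense a d0.
have near_p s : `|complex.Re (\tr (mx_ext (m s) a)) -
                  complex.Re (\tr (mx_ev (m s) p))| <= e / 3.
  rewrite -raddfB -lecR; apply: le_trans (normc_ge_Re _) _.
  rewrite -raddfB /=; apply: le_trans (ler_norm_sum _ _ _) _.
  apply: (@le_trans _ _ (\sum_(i < n) d%:C)).
    apply: ler_sum => i _; rewrite subE.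
    apply: le_trans (mx_ext_of_dist _ _ _ _ _) _; rewrite OA_normcE lecR; exact: hp.
  rewrite sumr_const card_ord -raddfMn lecR /= -[leRHS](@divfK _ n.+1%:R) ?pnatr_eq0 //.
  by rewrite -/d mulr_natr mulrS lerDr ltW.
have [cont _] : ccontinuous (fun s => \tr (mx_ev (m s) p)).
  by apply: ccontinuous_sum => i; exact: mx_ev_continuous.
have e3 : 0 < e / 3 by rewrite divr_gt0.
have /cvgrPdist_le /(_ _ e3) := cont t; apply: filterS => s hs.
have -> : e = e / 3 + (e / 3 + e / 3) by field.
apply: le_trans (ler_distD (complex.Re (\tr (mx_ev (m t) p))) _ _) _.
rewrite lerD //.
apply: le_trans (ler_distD (complex.Re (\tr (mx_ev (m s) p))) _ _) _.
by rewrite lerD // distrC.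
Qed.

Lemma tr_mx_ext_idempotent (a : OA R Q) : bmul a a = a ->
  forall s t, \tr (mx_ext (m s) a) = \tr (mx_ext (m t) a).
Proof.
move=> aa s t.
have trE u : \tr (mx_ext (m u) a) = (\rank (mx_ext (m u) a))%:R.
  by apply: tr_idempotent; rewrite -mx_extM aa.
rewrite !trE; congr _%:R; apply/eqP; rewrite -(eqr_nat R); apply/eqP.
have ReE u : complex.Re (\tr (mx_ext (m u) a)) = (\rank (mx_ext (m u) a))%:R.
  by rewrite trE raddfMn.
rewrite -!ReE.
apply: (@continuous_nat_constant (fun u => complex.Re (\tr (mx_ext (m u) a)))).
  exact: tr_mx_ext_continuous.
by move=> u; eexists; exact: ReE.
Qed.

End Paths.

(** * One-dimensional representations and deformation of characters *)

Section ScalarReps.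
Variables (R : realType) (Q : fin_digraph).
Local Notation A := (OA R Q).
Local Notation C := R[i].

Lemma ell2_mul_projection n (M : 'M[C]_n) :
  M *m M = M -> map_mx Num.conj M^T = M -> projection (ell2_mul M).
Proof.
move=> MM Msa; split=> [x|x y]; first by rewrite /ell2_mul -mulmxA MM.
change (dotmx ((x : 'rV[C]_n) *m M) (y : 'rV[C]_n) =
  dotmx (x : 'rV[C]_n) ((y : 'rV[C]_n) *m M)).
by rewrite !dotmxE trmx_mul map_mxM /= Msa mulmxA.
Qed.

Lemma ell2_mul_scalar_contr n (c : C) :
  `|c| <= 1 -> Defs.contraction (@ell2_mul R n c%:M).
Proof.
move=> c1 u; have -> : ell2_mul c%:M u = c *: u by rewrite /ell2_mul mul_mx_scalar.
by rewrite normrZ ler_piMl.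
Qed.

Lemma ell2_mul0_contr n : Defs.contraction (@ell2_mul R n 0).
Proof.
move=> u; have -> : ell2_mul 0 u = 0 by rewrite /ell2_mul mulmx0.
by rewrite normr0.
Qed.

Section Scalar.
Variables (x : vert Q -> C) (y : edge Q -> C).
Hypothesis x_idem : forall v, x v * x v = x v.
Hypothesis y_contr : forall e, `|y e| <= 1.
Hypothesis y_rng : forall e, y e * x (rng e) = y e.
Hypothesis y_src : forall e, x (src e) * y e = y e.

Definition scalar_rep : matrix_rep R Q 1.
refine (@MatrixRep R Q 1 (fun v => (x v)%:M) (fun e => (y e)%:M) _ _ _ _).
- move=> v; apply: ell2_mul_projection; first by rewrite -scalar_mxM x_idem.
  by rewrite tr_scalar_mx map_scalar_mx /= (idempotent_scalar (x_idem v)) conjC_nat.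
- by move=> e; exact: ell2_mul_scalar_contr.
- by move=> e; rewrite -scalar_mxM y_rng.
- by move=> e; rewrite -scalar_mxM y_src.
Defined.
End Scalar.

Lemma mx_ext_entry_linear n (m : matrix_rep R Q n) i j :
  linear (fun a : A => mx_ext m a i j : C^o).
Proof. by move=> c a b; rewrite !mx_ext_entry extD extZ !mxE. Qed.

Lemma mx_ext_entry_bounded n (m : matrix_rep R Q n) i j :
  bounded_op (fun a : A => mx_ext m a i j : C^o).
Proof.
exists 1 => a; have := mx_ext_of_dist m a (TZero R Q) i j.
by rewrite OA_of0 [mx_ev _ _ _ _]mxE !subr0 mul1r.
Qed.

(** The centre of the polydisc of characters with support [S]. *)
Definition vertex_char (S : {set vert Q}) (chi : {linear A -> C^o}) :=
  [/\ bounded_op chi, forall a b, chi (bmul a b) = chi a * chi b,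
      forall v, chi (Pv R v) = (v \in S)%:R & forall e, chi (Te R e) = 0].

Lemma vertex_char_exists S : exists chi, vertex_char S chi.
Proof.
have h1 v : ((v \in S)%:R * (v \in S)%:R : C) = (v \in S)%:R.
  by case: (v \in S); rewrite ?mulr1 ?mulr0.
have h2 (e : edge Q) : `|0 : C| <= 1 by rewrite normr0.
have h3 (e : edge Q) : 0 * (rng e \in S)%:R = 0 :> C by rewrite mul0r.
have h4 (e : edge Q) : (src e \in S)%:R * 0 = 0 :> C by rewrite mulr0.
pose m := scalar_rep h1 h2 h3 h4.
pose chi : {linear A -> C^o} := HB.pack (fun a : A => mx_ext m a 0 0 : C^o)
  (GRing.isLinear.Build C A C^o *:%R _ (mx_ext_entry_linear m 0 0)).
have chi_of p : chi (OA_of p) = mx_ev m p 0 0 by rewrite /= mx_ext_of.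
exists chi; split.
- exact: mx_ext_entry_bounded.
- by move=> a b; rewrite /= mx_extM [LHS]mxE big_ord1 mulrC.
- by move=> v; rewrite [LHS]chi_of mxE eqxx.
- by move=> e; rewrite [LHS]chi_of mxE eqxx.
Qed.

Lemma norm_Te_le1 (e : edge Q) : `|Te R e| <= 1.
Proof.
apply: (@norm_OA_of_le R Q (TEdge R e) 1 ler01) => pi x.
by rewrite mul1r; exact: rep_e_contr.
Qed.

Lemma ccontinuous_cos (c : C) : ccontinuous (fun t => (cos t)%:C * c).
Proof.
apply: ccontinuousM; last exact: ccontinuous_cst.
by apply: ccontinuous_real; exact: continuous_cos.
Qed.

(** The edge values are multiplied by [cos t], which goes from 1 at 0 to 0 at [pi / 2] and has
    modulus at most 1 for every real [t], so the path is defined on the whole line. In dimension one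
    the trace is the value of the character itself. *)
Lemma char_deform (chi chi0 : {linear A -> C^o}) (S : {set vert Q}) :
  bounded_op chi -> (forall a b, chi (bmul a b) = chi a * chi b) ->
  (forall v, chi (Pv R v) = (v \in S)%:R) -> vertex_char S chi0 ->
  forall p, bmul p p = p -> chi p = chi0 p.
Proof.
move=> chi_bd chi_mul chiv [chi0_bd chi0_mul chi0v chi0e] p pp.
have h1 v : chi (Pv R v) * chi (Pv R v) = chi (Pv R v) by rewrite -chi_mul Pv_idem.
have h2 t e : `|(cos t)%:C * chi (Te R e)| <= 1.
  rewrite normrM mulr_ile1 //.
    by rewrite normcR lecR ler_norml cos_geN1 cos_le1.
  by apply: le_trans (norm_Te_le1 e); exact: mult_functional_contr.
have h3 t e : ((cos t)%:C * chi (Te R e)) * chi (Pv R (rng e)) =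
    (cos t)%:C * chi (Te R e).
  by rewrite -mulrA [X in _ * X]mulrC -chi_mul Te_rng.
have h4 t e : chi (Pv R (src e)) * ((cos t)%:C * chi (Te R e)) =
    (cos t)%:C * chi (Te R e).
  by rewrite mulrCA [X in _ * X]mulrC -chi_mul Te_src.
pose m t := scalar_rep h1 (h2 t) (h3 t) (h4 t).
have := @tr_mx_ext_idempotent R Q 1 m _ _ p pp 0 (pi / 2).
rewrite (@mx_ext_tr_diag _ _ _ _ (fun=> chi)) //; first last.
- move=> e; apply/matrixP => i j; rewrite !mxE cos0 mul1r.
  by rewrite !ord1 !eqxx.
- by move=> v; apply/matrixP => i j; rewrite !mxE !ord1 !eqxx.
rewrite (@mx_ext_tr_diag _ _ _ _ (fun=> chi0)) //; first last.
- move=> e; apply/matrixP => i j; rewrite !mxE cos_pihalf mul0r.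
  by rewrite !ord1 !eqxx chi0e.
- by move=> v; apply/matrixP => i j; rewrite !mxE !ord1 !eqxx chiv chi0v.
rewrite !big_ord1; apply.
- by move=> v i j /=; exact: ccontinuous_cst.
- move=> e i j /=; rewrite !ord1; under eq_fun do rewrite mxE eqxx mulr1n.
  exact: ccontinuous_cos.
Qed.

End ScalarReps.

(** * Rotating lines in C^2 and additivity over the support *)

Section LineReps.
Variables (R : realType) (Q : fin_digraph).
Local Notation A := (OA R Q).
Local Notation C := R[i].

Definition line_coord (t : R) (i : 'I_2) : R := if i == 0 then cos t else sin t.
(** The orthogonal projection onto the line spanned by (cos t, sin t). *)
Definition line_proj (t : R) : 'M[C]_2 :=
  \matrix_(i, j) (line_coord t i * line_coord t j)%:C.

Lemma line_proj_projection t : projection (ell2_mul (line_proj t)).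
Proof.
apply: ell2_mul_projection; apply/matrixP => i j.
  rewrite !mxE; under eq_bigr do rewrite !mxE.
  rewrite big_ord_recl big_ord1 /= -!rmorphM -rmorphD /=; congr _%:C.
  have := cos2Dsin2 t; rewrite !expr2 => E.
  rewrite /line_coord /= -[RHS]mulr1 -E; ring.
by rewrite !mxE mulrC; apply: conj_Creal; rewrite complex_real.
Qed.

Variables S T : {set vert Q}.

(** With all edges acting by 0, any choice of projections for the vertices is a representation, even
    when the two lines are not orthogonal. *)
Definition two_lines_v (t : R) v : 'M[C]_2 :=
  if v \in S then line_proj 0 else if v \in T then line_proj t else 0.

Definition two_lines_rep (t : R) : matrix_rep R Q 2.
refine (@MatrixRep R Q 2 (two_lines_v t) (fun=> 0) _ _ _ _).
- move=> v; rewrite /two_lines_v; case: ifP => _; last case: ifP => _.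
  + exact: line_proj_projection.
  + exact: line_proj_projection.
  + by apply: ell2_mul_projection; rewrite ?mul0mx // trmx0 map_mx0.
- by move=> e; exact: ell2_mul0_contr.
- by move=> e; rewrite mul0mx.
- by move=> e; rewrite mulmx0.
Defined.

Lemma line_proj_continuous i j : ccontinuous (fun t => line_proj t i j).
Proof.
have -> : (fun t => line_proj t i j) =
    (fun t => (line_coord t i)%:C * (line_coord t j)%:C).
  by apply/funext => t; rewrite mxE rmorphM.
have lc k : ccontinuous (fun t => (line_coord t k)%:C).
  apply: ccontinuous_real => t; rewrite /line_coord; case: (k == 0).
    exact: continuous_cos.
  exact: continuous_sin.
exact: ccontinuousM.
Qed.

Lemma vertex_char0 (chi : {linear A -> C^o}) :
  vertex_char finset.set0 chi -> forall a, chi a = 0.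
Proof.
move=> [chi_bd chi_mul chiv chie].
apply: (@mult_functional_eq R Q chi (\0 : {linear A -> C^o})) => //.
- by exists 0 => b; rewrite normr0 mul0r.
- by move=> b c /=; rewrite mul0r.
- by move=> v; rewrite chiv inE.
Qed.

(* Rotating the line of the vertices of [T] from the line of those of [S] to its
   orthogonal complement deforms the direct sum of the characters of
   [S :|: T] and [set0] into that of the characters of [S] and [T]. *)
Lemma vertex_charU (chiS chiT chiU : {linear A -> C^o}) :
  (forall v, v \in S -> v \notin T) ->
  vertex_char S chiS -> vertex_char T chiT -> vertex_char (S :|: T) chiU ->
  forall p, bmul p p = p -> chiU p = chiS p + chiT p.
Proof.
move=> dST [bS mS vS eS] [bT mT vT eT] [bU mU vU eU] p pp.
have [chi0 hchi0] := vertex_char_exists R (@finset.set0 (vert Q)).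
have chi00 := vertex_char0 hchi0; have [b0 m0 v0 e0] := hchi0.
have := @tr_mx_ext_idempotent R Q 2 two_lines_rep _ _ p pp 0 (pi / 2).
rewrite (@mx_ext_tr_diag _ _ _ _ (fun i => if i == 0 then chiU else chi0)); first last.
- by move=> e; apply/matrixP => i j; rewrite !mxE; case: ifP; rewrite ?eU ?e0 mul0rn.
- move=> v; apply/matrixP => i j; rewrite /= /two_lines_v.
  case: i => [[|[|//]] ?]; case: j => [[|[|//]] ?]; rewrite !mxE /= ?vU ?v0 inE;
  case: (v \in S); case: (v \in T);
  by rewrite /= ?mxE /line_coord /= ?cos0 ?sin0 ?mulr0 ?mul0r ?mulr1.
- by move=> i; case: (i == 0).
- by move=> i; case: (i == 0).
rewrite (@mx_ext_tr_diag _ _ _ _ (fun i => if i == 0 then chiS else chiT)); first last.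
- by move=> e; apply/matrixP => i j; rewrite !mxE; case: ifP; rewrite ?eS ?eT mul0rn.
- move=> v; apply/matrixP => i j; rewrite /= /two_lines_v.
  have := dST v.
  case: i => [[|[|//]] ?]; case: j => [[|[|//]] ?]; rewrite !mxE /= ?vS ?vT;
  case: (v \in S); case: (v \in T) => // H;
  rewrite /= ?mxE /line_coord /= ?cos0 ?sin0 ?cos_pihalf ?sin_pihalf;
  rewrite ?mulr0 ?mul0r ?mulr1 //; by have := H isT.
- by move=> i; case: (i == 0).
- by move=> i; case: (i == 0).
rewrite !big_ord_recl !big_ord0 /= chi00 !addr0; apply.
- move=> v i j /=; rewrite /two_lines_v; case: (v \in S); last case: (v \in T).
  + exact: ccontinuous_cst.
  + exact: line_proj_continuous.
  + exact: ccontinuous_cst.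
- by move=> e i j /=; exact: ccontinuous_cst.
Qed.

End LineReps.

Lemma vertex_char_sum (R : realType) (Q : fin_digraph)
    (chi : {set vert Q} -> {linear OA R Q -> R[i]^o}) :
  (forall S, vertex_char S (chi S)) -> forall p, bmul p p = p ->
  forall S, chi S p = \sum_(w in S) chi [set w]%SET p.
Proof.
move=> hchi p pp S; have [k] := ubnP #|S|; elim: k S => // k IH S.
have [->|[w wS]] := set_0Vmem S.
  by rewrite big_set0 => _; exact: vertex_char0 (hchi _) p.
rewrite (cardsD1 w) wS ltnS => /IH hS; rewrite (big_setD1 w) //= -hS.
apply: (@vertex_charU R Q [set w]%SET (S :\ w)) => //.
  by move=> v; rewrite inE => /eqP ->; rewrite !inE eqxx.
by rewrite finset.setD1K.
Qed.

(** * Derivations *)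

Section Derivations.
Variables (R : realType) (Q : fin_digraph).
Local Notation A := (OA R Q).
Local Notation C := R[i].

(** Bounded derivations into the one-dimensional bimodule on which the algebra acts by [chi] on the
    left and by [chi'] on the right. Linearity is a clause, so that explicit combinations can be
    used directly. *)
Definition is_deriv (chi chi' d : A -> C^o) :=
  [/\ linear d, bounded_op d &
      forall a b, d (bmul a b) = chi a * d b + d a * chi' b].

Lemma is_derivB (chi chi' d1 d2 : A -> C^o) k :
  is_deriv chi chi' d1 -> is_deriv chi chi' d2 ->
  is_deriv chi chi' (fun a => d1 a - k * d2 a).
Proof.
move=> [l1 [M1 b1] m1] [l2 [M2 b2] m2]; split.
- by move=> c a b; rewrite l1 l2 /= /GRing.scale /=; ring.
- exists (M1 + `|k| * M2) => a; apply: le_trans (ler_normB _ _) _.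
  by rewrite mulrDl lerD // normrM -mulrA ler_wpM2l.
- by move=> a b; rewrite m1 m2; ring.
Qed.

Lemma is_deriv_sum n (chi chi' : A -> C^o) (d : 'I_n -> A -> C^o)
    (c : 'I_n -> C) :
  (forall i, is_deriv chi chi' (d i)) ->
  is_deriv chi chi' (fun a => \sum_i c i * d i a).
Proof.
move=> hd; split.
- move=> k a b; rewrite scaler_sumr -big_split; apply: eq_bigr => i _.
  by case: (hd i) => l _ _; rewrite l /GRing.scale /=; ring.
- have /choice [M hM] i : exists M, forall a, `|d i a| <= M * `|a|.
    by case: (hd i).
  exists (\sum_i `|c i| * M i) => a; apply: le_trans (ler_norm_sum _ _ _) _.
  rewrite mulr_suml; apply: ler_sum => i _.
  by rewrite normrM -mulrA ler_wpM2l.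
- move=> a b; rewrite mulr_sumr mulr_suml -big_split; apply: eq_bigr => i _.
  by case: (hd i) => _ _ m; rewrite m /=; ring.
Qed.

(** This is the inner derivation a.1 - 1.a of the bimodule. *)
Lemma is_deriv_diff (chi chi' : {linear A -> C^o}) :
  bounded_op chi -> bounded_op chi' ->
  (forall a b, chi (bmul a b) = chi a * chi b) ->
  (forall a b, chi' (bmul a b) = chi' a * chi' b) ->
  is_deriv chi chi' (fun a => chi a - chi' a).
Proof.
move=> [M hM] [M' hM'] m m'; split.
- by move=> k a b; rewrite !linearP /GRing.scale /=; ring.
- exists (M + M') => a; apply: le_trans (ler_normB _ _) _.
  by rewrite mulrDl lerD.
- by move=> a b; rewrite m m'; ring.
Qed.

Lemma is_deriv_eq0 (chi chi' d : A -> C^o) : is_deriv chi chi' d ->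
  (forall v, d (Pv R v) = 0) -> (forall e, d (Te R e) = 0) -> forall a, d a = 0.
Proof.
move=> [l bd m] dv de.
pose f : {linear A -> C^o} := HB.pack d (GRing.isLinear.Build _ _ _ _ _ l).
apply: (@eq0_on_terms _ _ _ f) => // p.
elim: p => [|v|e|p IHp q IHq|c p IHp|p IHp q IHq].
- by rewrite OA_of0 linear0.
- exact: dv.
- exact: de.
- by rewrite OA_ofD linearD IHp IHq addr0.
- by rewrite OA_ofZ linearZ IHp; exact: mulr0.
- rewrite OA_ofM; have := m (OA_of p) (OA_of q).
  by rewrite [d (OA_of q)]IHq [d (OA_of p)]IHp mulr0 mul0r addr0.
Qed.

(** * The derivation dual to an edge *)

Section ArrowRep.
Variable e0 : edge Q.

(** Coordinate 0 belongs to the range of [e0] and coordinate 1 to its source; for a loop the vertex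
    acts by the identity. *)
Definition arrow_v v : 'M[C]_2 :=
  diag_mx (\row_i (v == if i == 0 then rng e0 else src e0)%:R).
Definition arrow_e e : 'M[C]_2 := if e == e0 then delta_mx 1 0 else 0.

Definition arrow_rep : matrix_rep R Q 2.
refine (@MatrixRep R Q 2 arrow_v arrow_e _ _ _ _).
- move=> v; apply: ell2_mul_projection.
    rewrite /arrow_v mulmx_diag; congr diag_mx; apply/rowP => i; rewrite !mxE.
    by case: eqP; rewrite ?mulr1 ?mulr0.
  rewrite /arrow_v tr_diag_mx map_diag_mx; congr diag_mx; apply/rowP => i.
  by rewrite !mxE /= conjC_nat.
- move=> e; rewrite /arrow_e; case: eqP => _; last exact: ell2_mul0_contr.
  move=> u; have -> : ell2_mul (delta_mx 1 0) u =
      u 0 1 *: (delta_mx 0 0 : ell2 R 2).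
    apply/rowP => j; rewrite !mxE (bigD1 1) //= big1 ?addr0 => [|k k1].
      by rewrite !mxE eqxx.
    by rewrite mxE (negbTE k1) mulr0.
  by rewrite normrZ ell2_norm_delta mulr1 ell2_coord_le.
- move=> e; rewrite /arrow_e; case: eqP => [->|_]; last by rewrite mul0mx.
  apply/matrixP => i j; rewrite mul_mx_diag !mxE.
  by case: (j =P 0) => _; rewrite ?eqxx ?mulr1 // andbF mul0r.
- move=> e; rewrite /arrow_e; case: eqP => [->|_]; last by rewrite mulmx0.
  apply/matrixP => i j; rewrite mul_diag_mx !mxE.
  by case: (i =P 1) => [->|_]; rewrite /= ?eqxx ?mul1r // mulr0.
Defined.

(** The representation is lower triangular, with diagonal entries [chi] and [chi'], and
    multiplicativity of the matrices is the Leibniz rule for the entry below the diagonal. The first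
    basis vector is a joint eigenvector, which gives row 0; the entry (1, 1) is then multiplicative
    and is identified on generators. *)
Lemma arrow_deriv (chi chi' : {linear A -> C^o}) :
  vertex_char [set rng e0]%SET chi -> vertex_char [set src e0]%SET chi' ->
  exists d, [/\ is_deriv chi chi' d, forall v, d (Pv R v) = 0 &
    forall e, d (Te R e) = (e == e0)%:R].
Proof.
move=> [bd mul cv ce] [bd' mul' cv' ce']; pose X := mx_ext arrow_rep.
have X_of p : X (OA_of p) = mx_ev arrow_rep p by exact: mx_ext_of.
have X0 a j : X a 0 j = chi a * (j == 0)%:R.
  rewrite [LHS]mx_ext_entry (@ext_eigen _ _ _ _ chi) //; first by rewrite !mxE.
    move=> v /=; rewrite /ell2_mul /arrow_v -rowE; apply/rowP => k.
    rewrite !mxE eqxx cv inE; case: (k =P 0) => [->|k0]; rewrite ?eqxx ?mulr1 //.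
    by move/eqP: k0; rewrite eq_sym mulr0 => /negbTE ->.
  move=> e /=; rewrite /ell2_mul /arrow_e -rowE ce scale0r; apply/rowP => k.
  by case: eqP; rewrite !mxE.
have X11M a b : X (bmul a b) 1 1 = X a 1 1 * X b 1 1.
  rewrite /X mx_extM [LHS]mxE big_ord_recl big_ord1 -/(X a) -/(X b).
  by rewrite X0 mulr0 mulr0 add0r mulrC; congr (X a _ _ * X b _ _); apply/val_inj.
have X11 a : X a 1 1 = chi' a.
  pose f : {linear A -> C^o} := HB.pack (fun a : A => X a 1 1 : C^o)
    (GRing.isLinear.Build C A C^o *:%R _ (mx_ext_entry_linear arrow_rep 1 1)).
  apply: (@mult_functional_eq R Q f chi') => //.
  - exact: mx_ext_entry_bounded.
  - by move=> v; rewrite [LHS](congr1 (fun M : 'M_2 => M 1 1) (X_of _)) cv' !mxE inE.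
  - move=> e; rewrite [LHS](congr1 (fun M : 'M_2 => M 1 1) (X_of _)) ce' /= /arrow_e.
    by case: eqP; rewrite mxE.
exists (fun a => X a 1 0); split.
- split; [exact: mx_ext_entry_linear|exact: mx_ext_entry_bounded|].
  move=> a b; rewrite /X mx_extM [LHS]mxE big_ord_recl big_ord1 -/(X a) -/(X b).
  rewrite X0 eqxx mulr1 mulrC -X11; congr (_ + _); rewrite mulrC.
  by congr (X a _ _ * X b _ _); apply/val_inj.
- by move=> v; rewrite X_of !mxE.
- by move=> e; rewrite X_of /= /arrow_e; case: eqP; rewrite !mxE.
Qed.

End ArrowRep.
End Derivations.

(** * Products of two reflections and bounded derivations *)

Section Reflections.
Variables (R : realType) (Q : fin_digraph).
Local Notation A := (OA R Q).
Local Notation C := R[i].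

Lemma reflection_isometry (H : hilbert R) (P : {linear H -> H}) x :
  projection P -> `|P x *+ 2 - x| = `|x|.
Proof.
move=> [PP Psa].
have E : hdot (P x *+ 2 - x) (P x *+ 2 - x) = hdot x x.
  have PxPx : hdot (P x) (P x) = hdot (P x) x by rewrite Psa PP -Psa.
  have xPx : hdot x (P x) = hdot (P x) x by rewrite -Psa.
  rewrite linearBl /= !linearBr /= mulr2n !linearDl /= !linearDr /=.
  by rewrite xPx PxPx; ring.
by apply/eqP; rewrite -(@eqrXn2 _ 2) // -!hdotE E.
Qed.

Variables p q : vert Q.

(** The expansion of [(2p - 1)(2q - 1) - 1]. Terms contain no unit, so 1 is subtracted to cancel the
    constant. *)
Definition rot_term : term R Q :=
  TAdd (TScale 4 (TMul (TVert R p) (TVert R q)))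
       (TScale (- 2%:R) (TAdd (TVert R p) (TVert R q))).

Fixpoint rot_pow n : term R Q :=
  if n is n'.+1 then
    TAdd (TAdd (rot_pow n') rot_term) (TMul (rot_pow n') rot_term)
  else TZero R Q.

(* [1 + rot_pow n] is the n-th power of the product [(2p - 1)(2q - 1)] of two
   unitary reflections. *)
Lemma norm_rot_pow n : `|OA_of (rot_pow n)| <= (2 : R)%:C.
Proof.
apply: norm_OA_of_le => // pi x; rewrite rmorph_nat.
pose U (y : rep_sp pi) := let z := rep_v pi q y *+ 2 - y in rep_v pi p z *+ 2 - z.
have UE y : ev rot_term y = U y - y.
  rewrite /= /U /= linearB (raddfMn (rep_v pi p)) /=.
  rewrite scalerDr !scaleNr !scaler_nat mulrnBl -mulrnA addrA.
  by rewrite opprB addrA [RHS]addrAC addrK.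
have U_norm y : `|U y| = `|y|.
  by rewrite /U !reflection_isometry //; exact: rep_v_proj.
suff : `|ev (rot_pow n) x + x| = `|x|.
  move=> E; have -> : ev (rot_pow n) x = ev (rot_pow n) x + x - x by rewrite addrK.
  by apply: le_trans (ler_normB _ _) _; rewrite E -mulr2n mulr_natl.
elim: n x => [|n IH] x; first by rewrite /= add0r.
rewrite -[RHS]U_norm -[RHS]IH; congr `|_|.
change (ev (rot_pow n) x + ev rot_term x + ev (rot_pow n) (ev rot_term x) + x =
  ev (rot_pow n) (U x) + U x).
rewrite UE linearB /= addrAC -(addrA (ev (rot_pow n) x)) subrK [LHS]addrC.
by rewrite addrA subrK.
Qed.

(** With U = 1 + [rot_term], both characters are -1 at U, so d(U^n - 1) equals n d(U - 1) up to
    sign, and d(U - 1) is twice the sum in question. The elements U^n - 1 have norm at most 2. *)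
Lemma deriv_reflection (chi chi' : {linear A -> C^o}) (d : A -> C^o) :
  (forall a b, chi (bmul a b) = chi a * chi b) ->
  (forall a b, chi' (bmul a b) = chi' a * chi' b) ->
  is_deriv chi chi' d ->
  chi (Pv R p) = 1 :> C -> chi (Pv R q) = 0 :> C ->
  chi' (Pv R p) = 0 :> C -> chi' (Pv R q) = 1 :> C ->
  d (Pv R p) + d (Pv R q) = 0.
Proof.
move=> mchi mchi' [ld bd md] p1 q0 p0' q1'.
pose f : {linear A -> C^o} :=
  HB.pack d (GRing.isLinear.Build C A C^o *:%R _ ld).
have fM a b : f (bmul a b) = chi a * f b + f a * chi' b by exact: md.
rewrite -[d _]/(f (Pv R p)) -[d (Pv R q)]/(f (Pv R q)).
set delta := _ + _; pose z := OA_of rot_term.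
have zE : z = 4 *: bmul (Pv R p) (Pv R q) + (- 2%:R) *: (Pv R p + Pv R q).
  by rewrite /z OA_ofD !OA_ofZ OA_ofM OA_ofD.
have linz (h : {linear A -> C^o}) :
    h z = 4 * h (bmul (Pv R p) (Pv R q)) - 2 * (h (Pv R p) + h (Pv R q)) :> C.
  have hD a b : h (a + b) = h a + h b :> C by exact: linearD.
  have hZ c a : h (c *: a) = c * h a :> C by exact: linearZ.
  by rewrite zE hD !hZ hD mulNr.
have chiz : chi z = - 2 :> C by rewrite linz mchi p1 q0; ring.
have chi'z : chi' z = - 2 :> C by rewrite linz mchi' p0' q1'; ring.
have fz : f z = 2 * delta :> C by rewrite linz fM p1 q1' /delta; ring.
have powS n : OA_of (rot_pow n.+1) =
    OA_of (rot_pow n) + z + bmul (OA_of (rot_pow n)) z.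
  by rewrite OA_ofD OA_ofD OA_ofM.
have chi_pow n : chi (OA_of (rot_pow n)) = (-1) ^+ n - 1 :> C.
  elim: n => [|n IH]; first by rewrite OA_of0 linear0 expr0 subrr.
  by rewrite powS !linearD mchi chiz IH exprS /=; ring.
have f_pow n : f (OA_of (rot_pow n)) = - (-1) ^+ n * n%:R * (2 * delta) :> C.
  elim: n => [|n IH]; first by rewrite OA_of0 linear0 mulr0 mul0r.
  by rewrite powS !linearD fM chi'z fz chi_pow IH exprS -natr1 /=; ring.
have [M M0 fbd] := bounded_op_ge0 (bd : bounded_op f).
apply/eqP; rewrite -normr_eq0; apply/negPn/negP => nz.
have npos : 0 < complex.Re `|delta| .
  by rewrite -ltcR normC_Re lt_def nz normr_ge0.
(* The least convenient power: n |delta| exceeds M, against 2 n |delta| <= 2 M. *)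
pose n := (Num.truncn (M / complex.Re `|delta|)).+1.
have : M < n%:R * complex.Re `|delta| by rewrite -ltr_pdivrMr // truncnS_gt.
apply/negP; rewrite -leNgt.
rewrite -(@ler_pM2r _ 2) // -lecR.
have := fbd (OA_of (rot_pow n)).
rewrite f_pow !normrM normrN normrX normrN1 expr1n mul1r !normr_nat => h.
rewrite !rmorphM /= Re_normcE.
have -> : (n%:R)%:C * `|delta| * 2%:C = n%:R * (2 * `|delta|) :> C.
  by rewrite !rmorph_nat; ring.
by apply: le_trans h _; rewrite ler_wpM2l ?ler0c // norm_rot_pow.
Qed.

End Reflections.

(** * Comparing numbers of edges *)

Section EdgeCount.
Variable R : realType.
Local Notation C := R[i].

Lemma deriv_normalize (Q : fin_digraph) (chi chi' : {linear OA R Q -> C^o})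
    (d : OA R Q -> C^o) (w w' : vert Q) :
  bounded_op chi -> bounded_op chi' ->
  (forall a b, chi (bmul a b) = chi a * chi b) ->
  (forall a b, chi' (bmul a b) = chi' a * chi' b) ->
  (forall u, chi (Pv R u) = (u == w)%:R) ->
  (forall u, chi' (Pv R u) = (u == w')%:R) ->
  is_deriv chi chi' d ->
  exists k, let d' := fun a => d a - k * (chi a - chi' a) in
    (forall u, d' (Pv R u) = 0) /\
    (forall e, ~~ ((rng e == w) && (src e == w')) -> d' (Te R e) = 0).
Proof.
move=> bd bd' m m' cv cv' hd.
(* For w different from w' this kills d(P_w), and [deriv_reflection] then gives d'(P_w') = 0. For w
   = w' the two characters agree on vertices, and idempotence gives d(P_w) = 2 d(P_w). *)
exists (if w == w' then 0 else d (Pv R w)); set k := if _ then _ else _.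
have [_ _ dM] := hd.
have vert0 u : d (Pv R u) - k * (chi (Pv R u) - chi' (Pv R u)) = 0.
  have Eu : d (Pv R u) = (u == w)%:R * d (Pv R u) + d (Pv R u) * (u == w')%:R :> C.
    by rewrite -cv -cv' -[in LHS](Pv_idem R u); exact: dM.
  rewrite cv cv' /k.
  have [uw|uw] := eqVneq u w; have [uw'|uw'] := eqVneq u w'.
  - rewrite subrr mulr0 subr0; move: Eu.
    have <- : w = w' by rewrite -uw.
    rewrite uw eqxx mul1r mulr1.
    by move=> /(congr1 (fun z => z - d (Pv R w))); rewrite subrr addrK => <-.
  - by rewrite -uw (negbTE uw') subr0 mulr1 subrr.
  - have ww' : w != w' by rewrite -uw' eq_sym.
    rewrite (negbTE ww') sub0r mulrN1 opprK uw' addrC.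
    by apply: (@deriv_reflection R Q w w' chi chi' d);
      rewrite ?cv ?cv' ?eqxx // ?(negbTE ww') // eq_sym (negbTE ww').
  - rewrite subrr mulr0 subr0; move: Eu.
    by rewrite (negbTE uw) (negbTE uw') mul0r mulr0 addr0.
split=> // e hne; have [_ _ d'M] :=
  is_derivB k hd (is_deriv_diff bd bd' m m').
(* An edge that does not run from w' to w is absorbed at one end by a vertex whose character value
   is 0 and at which d' vanishes. *)
have [/eqP rw|rw] := boolP (rng e == w).
  have sw : src e != w' by move: hne; rewrite rw eqxx.
  have := d'M (Te R e) (Pv R (src e)).
  by rewrite Te_src vert0 cv' (negbTE sw) !mulr0 addr0.
have := d'M (Pv R (rng e)) (Te R e).
by rewrite Te_rng vert0 cv (negbTE rw) !mul0r addr0.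
Qed.

Definition edges_between (Q : fin_digraph) (v v' : vert Q) : {set edge Q} :=
  [set e | (rng e == v) && (src e == v')]%SET.

(** The derivations dual to the edges from v' to v, pulled back along [g] and normalized, are
    determined by their values on the edges from w' to w. They are independent: at f(T_e) both
    characters contribute 0, so the corrections disappear and duality with the edges reads off each
    coefficient. *)
Lemma edge_count_le (Q1 Q2 : fin_digraph) (g : {linear OA R Q2 -> OA R Q1})
    (f : OA R Q1 -> OA R Q2) (chi chi' : {linear OA R Q1 -> C^o})
    (v v' : vert Q1) (w w' : vert Q2) :
  bounded_op g -> (forall a b, g (bmul a b) = bmul (g a) (g b)) -> cancel f g ->
  vertex_char [set v]%SET chi -> vertex_char [set v']%SET chi' ->
  (forall u, chi (g (Pv R u)) = (u == w)%:R) ->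
  (forall u, chi' (g (Pv R u)) = (u == w')%:R) ->
  (#|edges_between v v'| <= #|edges_between w w'|)%N.
Proof.
move=> bg mg fK hchi hchi' cw cw'.
have [[bd m cv ce] [bd' m' cv' ce']] := (hchi, hchi').
set I := edges_between v v'; set J := edges_between w w'.
have comp_bd (h : {linear OA R Q1 -> C^o}) :
    bounded_op h -> bounded_op (h \o g).
  by move=> bh; exact: bounded_op_comp.
have /choice [d hd] (i : 'I_#|I|) : exists d,
    [/\ is_deriv chi chi' d, forall u, d (Pv R u) = 0 &
      forall e, d (Te R e) = (e == enum_val i)%:R].
  have := enum_valP i; rewrite inE => /andP[/eqP ri /eqP si].
  by apply: arrow_deriv; rewrite ?ri ?si.
have hdg i : is_deriv (chi \o g) (chi' \o g) (d i \o g).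
  have [[ld bdd md] _ _] := hd i.
  pose di : {linear OA R Q1 -> C^o} :=
    HB.pack (d i) (GRing.isLinear.Build _ _ _ _ _ ld).
  split; [exact: (linearP (di \o g))|exact: (comp_bd di)|].
  by move=> a b /=; rewrite mg md.
have hmg a b : (chi \o g) (bmul a b) = (chi \o g) a * (chi \o g) b.
  by rewrite /= mg m.
have hmg' a b : (chi' \o g) (bmul a b) = (chi' \o g) a * (chi' \o g) b.
  by rewrite /= mg m'.
have /choice [k hk] i :=
  deriv_normalize (comp_bd _ bd) (comp_bd _ bd') hmg hmg' cw cw' (hdg i).
pose D i a : C^o := d i (g a) - k i * (chi (g a) - chi' (g a)).
pose M : 'M[C]_(#|I|, #|J|) := \matrix_(i, j) D i (Te R (enum_val j)).
suff : row_free M by rewrite /row_free => /eqP <-; exact: rank_leq_col.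
apply/inj_row_free => c cM.
have sum0 : forall a, \sum_i c 0 i * D i a = 0.
  apply: (@is_deriv_eq0 R Q2 (chi \o g) (chi' \o g)).
  - apply: is_deriv_sum => i; apply: is_derivB; first exact: hdg.
    exact: (is_deriv_diff (comp_bd _ bd) (comp_bd _ bd') hmg hmg').
  - by move=> u; apply: big1 => i _; have [h _] := hk i; rewrite [D _ _]h mulr0.
  - move=> e; have [eJ|eJ] := boolP (e \in J); last first.
      apply: big1 => i _; have [_ h] := hk i; rewrite [D _ _]h ?mulr0 //.
      by move: eJ; rewrite inE.
    have := congr1 (fun X : 'rV_ _ => X 0 (enum_rank_in eJ e)) cM.
    rewrite !mxE => E; rewrite -[RHS]E; apply: eq_bigr => i _.
    by rewrite !mxE enum_rankK_in.
apply/rowP => i; rewrite [RHS]mxE; have := sum0 (f (Te R (enum_val i))).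
rewrite (bigD1 i) //= big1 => [|j ji].
  rewrite /D fK ce ce' subrr mulr0 subr0 addr0; have [_ _ ->] := hd i.
  by rewrite eqxx mulr1.
rewrite /D fK ce ce' subrr mulr0 subr0; have [_ _ ->] := hd j.
by rewrite (inj_eq enum_val_inj) eq_sym (negbTE ji) mulr0.
Qed.

End EdgeCount.

(** * Recovering the graph *)

Section Matching.
Variable R : realType.
Local Notation C := R[i].

Lemma vertex_char_idempotent_uniq (Q : fin_digraph)
    (chi : {set vert Q} -> {linear OA R Q -> C^o}) :
  (forall S, vertex_char S (chi S)) -> forall p, bmul p p = p ->
  forall w w', chi [set w]%SET p != 0 -> chi [set w']%SET p != 0 -> w = w'.
Proof.
move=> hchi p pp w w' nw nw'.
have val01 S : chi S p = (chi S p != 0)%:R.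
  have [_ m _ _] := hchi S.
  by apply: idempotent_scalar; rewrite -m pp.
apply/eqP/negPn/negP => ww'.
have := vertex_char_sum hchi pp [set w; w']%SET.
have dis : w \notin [set w']%SET by rewrite inE.
rewrite big_setU1 //= big_set1 val01 (val01 [set w]%SET) (val01 [set w']%SET).
rewrite nw nw' -natrD => /eqP; rewrite eqr_nat; by case: (_ != 0).
Qed.

Variables (Q1 Q2 : fin_digraph).
Variables (f : {linear OA R Q1 -> OA R Q2}) (g : {linear OA R Q2 -> OA R Q1}).
Hypothesis f_bd : bounded_op f.
Hypothesis g_bd : bounded_op g.
Hypothesis fM : forall a b, f (bmul a b) = bmul (f a) (f b).
Hypothesis gM : forall a b, g (bmul a b) = bmul (g a) (g b).
Hypothesis fK : cancel f g.
Variable chi1 : {set vert Q1} -> {linear OA R Q1 -> C^o}.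
Variable chi2 : {set vert Q2} -> {linear OA R Q2 -> C^o}.
Hypothesis hchi1 : forall S, vertex_char S (chi1 S).
Hypothesis hchi2 : forall S, vertex_char S (chi2 S).

(** The transported character [chi1 [set v] \o g] takes the value 1 at the idempotent f(P_v).
    Additivity over its support yields a w in the support whose own character is nonzero there. *)
Lemma vertex_match_exists v : exists w,
  chi1 [set v]%SET (g (Pv R w)) != 0 /\ chi2 [set w]%SET (f (Pv R v)) != 0.
Proof.
have [bd m cv ce] := hchi1 [set v]%SET.
pose psi : {linear OA R Q2 -> C^o} := chi1 [set v]%SET \o g.
have psiM a b : psi (bmul a b) = psi a * psi b by rewrite /psi /= gM m.
have psi_bd : bounded_op psi by exact: bounded_op_comp.
pose S := [set w | psi (Pv R w) != 0]%SET.
have psiv w : psi (Pv R w) = (w \in S)%:R.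
  by rewrite inE; exact: mult_functional_Pv.
have pp : bmul (f (Pv R v)) (f (Pv R v)) = f (Pv R v) by rewrite -fM Pv_idem.
have := char_deform psi_bd psiM psiv (hchi2 S) pp.
rewrite (vertex_char_sum hchi2 pp) /psi /= fK cv inE eqxx => E.
have [w wS|all0] :=
  pickP [pred w | (w \in S) && (chi2 [set w]%SET (f (Pv R v)) != 0)].
  by exists w; move: wS => /andP[]; rewrite inE.
move: E; rewrite big1 => [/eqP|w wS]; first by rewrite oner_eq0.
by have := all0 w; rewrite /= wS => /negbT; rewrite negbK => /eqP.
Qed.

End Matching.

Section Main.
Variable R : realType.
Local Notation C := R[i].
Lemma vertex_bijection (Q1 Q2 : fin_digraph)
  (f : {linear OA R Q1 -> OA R Q2}) (g : {linear OA R Q2 -> OA R Q1})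
  (chi1 : {set vert Q1} -> {linear OA R Q1 -> C^o})
  (chi2 : {set vert Q2} -> {linear OA R Q2 -> C^o}) :
  bounded_op f -> bounded_op g ->
  (forall a b, f (bmul a b) = bmul (f a) (f b)) ->
  (forall a b, g (bmul a b) = bmul (g a) (g b)) ->
  cancel f g -> cancel g f ->
  (forall S, vertex_char S (chi1 S)) -> (forall S, vertex_char S (chi2 S)) ->
  exists s : vert Q1 -> vert Q2,
    (forall v w, chi1 [set v]%SET (g (Pv R w)) = (w == s v)%:R) /\
    (forall v, chi2 [set s v]%SET (f (Pv R v)) != 0).
Proof.
move=> fb gb fM gM fK gK h1 h2.
have /choice [s hs] v := vertex_match_exists gb fM gM fK h1 h2 v.
exists s; split=> [v w|v]; last by have [] := hs v.
have gP w' : bmul (g (Pv R w')) (g (Pv R w')) = g (Pv R w') by rewrite -gM Pv_idem.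
have fP w' : bmul (f (Pv R w')) (f (Pv R w')) = f (Pv R w') by rewrite -fM Pv_idem.
have [_ m _ _] := h1 [set v]%SET.
rewrite [LHS]idempotent_scalar; last by rewrite -m gP.
congr _%:R; congr nat_of_bool; apply/idP/eqP => [nz|->]; last by have [] := hs v.
(* A transported character could have several vertices in its support. Matching w back gives v1;
   uniqueness at g(P_w) yields v1 = v, and uniqueness at f(P_v) then yields w = s v. *)
have [v1 [n1 n2]] := vertex_match_exists fb gM fM gK h2 h1 w.
have E : v1 = v by apply: (vertex_char_idempotent_uniq h1 (gP w)).
rewrite E in n1; have [_ n3] := hs v.
exact: (vertex_char_idempotent_uniq h2 (fP v)).
Qed.

(** Within each class of parallel edges, the k-th edge is sent to the k-th edge of the target class.
    Injectivity of [s] lets the image determine the class. *)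
Lemma edge_embedding (Q1 Q2 : fin_digraph) (s : vert Q1 -> vert Q2) :
  injective s ->
  (forall v v', (#|edges_between v v'| <= #|edges_between (s v) (s v')|)%N) ->
  exists h : edge Q1 -> edge Q2, [/\ injective h,
    forall e, rng (h e) = s (rng e) & forall e, src (h e) = s (src e)].
Proof.
move=> s_inj hcard.
pose I (e : edge Q1) := edges_between (rng e) (src e).
pose J (e : edge Q1) := edges_between (s (rng e)) (s (src e)).
have eI e : e \in I e by rewrite inE !eqxx.
have /choice [h hh] e : exists e2,
    e2 \in J e /\ index e2 (enum (J e)) = index e (enum (I e)).
  have lt : (index e (enum (I e)) < size (enum (J e)))%N.
    rewrite -cardE; apply: leq_trans (hcard _ _).
    by rewrite cardE index_mem mem_enum eI.
  case def_s: (enum (J e)) lt => [//|x r] lt.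
  exists (nth x (x :: r) (index e (enum (I e)))); split.
    by rewrite -mem_enum def_s mem_nth.
  by rewrite index_uniq // -def_s enum_uniq.
have hr e : rng (h e) = s (rng e) by have [] := hh e; rewrite inE => /andP[/eqP].
have hsrc e : src (h e) = s (src e) by have [] := hh e; rewrite inE => /andP[_ /eqP].
exists h; split=> // e e' ee'.
have Er : rng e = rng e' by apply: s_inj; rewrite -!hr ee'.
have Es : src e = src e' by apply: s_inj; rewrite -!hsrc ee'.
have [_ i1] := hh e; have [_ i2] := hh e'.
have IE : I e = I e' by rewrite /I Er Es.
have JE : J e = J e' by rewrite /J Er Es.
apply: (@index_inj _ e (enum (I e))).
- by rewrite mem_enum.
- by rewrite mem_enum IE.
- by rewrite /= -i1 IE -i2 ee' JE.
Qed.

Lemma digraph_isomorphic_of_banach (Q1 Q2 : fin_digraph) :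
  banach_isomorphic (OA R Q1) (OA R Q2) -> digraph_isomorphic Q1 Q2.
Proof.
move=> [f [g0 [fM fK gK fb g0b]]].
have gl : linear g0 := can2_linear fK gK.
pose g : {linear OA R Q2 -> OA R Q1} :=
  HB.pack g0 (GRing.isLinear.Build _ _ _ _ _ gl).
have gM a b : g (bmul a b) = bmul (g a) (g b).
  by apply: (can_inj fK); rewrite fM /= !gK.
have /choice [chi1 h1] := fun S => @vertex_char_exists R Q1 S.
have /choice [chi2 h2] := fun S => @vertex_char_exists R Q2 S.
have [s [s1 s2]] := vertex_bijection fb (g0b : bounded_op g) fM gM fK gK h1 h2.
have [t [t1 t2]] := vertex_bijection (g0b : bounded_op g) fb gM fM gK fK h2 h1.
have sK : cancel s t.
  by move=> v; have := s2 v; rewrite t1; case: (v =P _) => [E _|_] //; rewrite eqxx.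
have tK : cancel t s.
  by move=> w; have := t2 w; rewrite s1; case: (w =P _) => [E _|_] //; rewrite eqxx.
have [h [h_inj hr hs]] : exists h : edge Q1 -> edge Q2, [/\ injective h,
    forall e, rng (h e) = s (rng e) & forall e, src (h e) = s (src e)].
  apply: edge_embedding (can_inj sK) _ => v v'.
  exact: (edge_count_le (g0b : bounded_op g) gM fK (h1 _) (h1 _) (s1 v) (s1 v')).
(* [k] serves only to compare cardinalities and need not invert [h]: an injection between finite
   sets of equal size is bijective. *)
have [k [k_inj _ _]] : exists h : edge Q2 -> edge Q1, [/\ injective h,
    forall e, rng (h e) = t (rng e) & forall e, src (h e) = t (src e)].
  apply: edge_embedding (can_inj tK) _ => v v'.
  exact: (edge_count_le fb fM gK (h2 _) (h2 _) (t1 v) (t1 v')).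
exists s, h; split=> //; first by exists t.
by apply: inj_card_bij h_inj _; exact: leq_card k_inj.
Qed.

End Main.

(** * Functoriality *)

Section Functoriality.
Variables (R : realType) (Q1 Q2 : fin_digraph).
Variables (f : vert Q1 -> vert Q2) (g : edge Q1 -> edge Q2).

Fixpoint term_map (p : term R Q1) : term R Q2 :=
  match p with
  | TZero => TZero R Q2
  | TVert v => TVert R (f v)
  | TEdge e => TEdge R (g e)
  | TAdd p q => TAdd (term_map p) (term_map q)
  | TScale c p => TScale c (term_map p)
  | TMul p q => TMul (term_map p) (term_map q)
  end.

Hypothesis f_rng : forall e, rng (g e) = f (rng e).
Hypothesis f_src : forall e, src (g e) = f (src e).

Definition crep_pullback (pi : crep R Q2) : crep R Q1.
refine (@CRep R Q1 (rep_sp pi) (fun v => rep_v pi (f v))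
  (fun e => rep_e pi (g e)) _ _ _ _).
- by move=> v; exact: rep_v_proj.
- by move=> e; exact: rep_e_contr.
- by move=> e x; rewrite -f_rng rep_rng.
- by move=> e x; rewrite -f_src rep_src.
Defined.

Lemma ev_term_map (pi : crep R Q2) p (x : rep_sp pi) :
  ev (term_map p) x = @ev R Q1 (crep_pullback pi) p x.
Proof.
elim: p x => //= [p IHp q IHq|c p IHp|p IHp q IHq] x; by rewrite ?IHp ?IHq.
Qed.

(** Representations of [Q2] pull back to representations of [Q1], so the supremum on the right runs
    over at least as many. Any graph morphism thus induces a contractive homomorphism. *)
Lemma unorm_term_map p : unorm (term_map p) <= unorm p.
Proof.
apply: unorm_le => [|pi x]; first exact: unorm_ge0.
by rewrite ev_term_map; exact: (@ev_le R Q1 (crep_pullback pi)).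
Qed.

Lemma tcauchy_term_map (u : cseq R Q1) : tcauchy (fun n => term_map (u n)).
Proof.
move=> eps /(cseqP u) [N hN]; exists N => m n Nm Nn.
exact: le_lt_trans (unorm_term_map (tsub (u m) (u n))) (hN _ _ Nm Nn).
Qed.

Definition OA_map (a : OA R Q1) : OA R Q2 :=
  cls (CSeq (tcauchy_term_map (repr a))).

Lemma OA_mapE u : OA_map (cls u) = cls (CSeq (tcauchy_term_map u)).
Proof.
apply/clsP/ceqP => eps e0; have /ceqP /(_ _ e0) [N hN] := ceq_repr u.
exists N => n Nn; apply: le_lt_trans (hN n Nn).
exact: (unorm_term_map (tsub _ _)).
Qed.

Lemma OA_map_linear : linear OA_map.
Proof.
move=> c a b; have [u ->] := cls_surj a; have [v ->] := cls_surj b.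
have comb Q (x y : cseq R Q) :
    c *: (cls x : OA R Q) + cls y = cls (cadd (cscale c x) y).
  by rewrite -OA_addE -OA_scaleE.
apply: etrans (congr1 OA_map (comb _ u v)) _; rewrite !OA_mapE.
by apply: etrans (esym (comb _ _ _)); apply: cls_ev.
Qed.

Lemma OA_mapM a b : OA_map (bmul a b) = bmul (OA_map a) (OA_map b).
Proof.
have [u ->] := cls_surj a; have [v ->] := cls_surj b.
rewrite [bmul _ _ in LHS]OA_mulE !OA_mapE [RHS]OA_mulE; exact: cls_ev.
Qed.

Lemma OA_map_norm a : `|OA_map a| <= `|a|.
Proof.
have [u ->] := cls_surj a; rewrite OA_mapE !OA_normcE lecR !OA_normE.
apply: ler_lim; [exact: is_cvg_unorm|exact: is_cvg_unorm|].
by apply: nearW => n; exact: unorm_term_map.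
Qed.

End Functoriality.

Lemma banach_isomorphic_of_digraph (R : realType) (Q1 Q2 : fin_digraph) :
  digraph_isomorphic Q1 Q2 -> banach_isomorphic (OA R Q1) (OA R Q2).
Proof.
move=> [f [g [[f' fK f'K] [g' gK g'K] hr hs]]].
have hr' e : rng (g' e) = f' (rng e) by apply: (can_inj fK); rewrite f'K -hr g'K.
have hs' e : src (g' e) = f' (src e) by apply: (can_inj fK); rewrite f'K -hs g'K.
have tK : cancel (term_map (R := R) f g) (term_map f' g').
  by elim=> //= [v|e|p -> q ->|c p ->|p -> q ->]; rewrite ?fK ?gK.
have tK' : cancel (term_map (R := R) f' g') (term_map f g).
  by elim=> //= [v|e|p -> q ->|c p ->|p -> q ->]; rewrite ?f'K ?g'K.
pose F : {linear OA R Q1 -> OA R Q2} := HB.pack (OA_map (R := R) hr hs)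
  (GRing.isLinear.Build _ _ _ _ _ (OA_map_linear hr hs)).
exists F, (OA_map (R := R) hr' hs'); split.
- exact: OA_mapM.
- move=> a; have [u ->] := cls_surj a; rewrite /= !OA_mapE.
  by apply: cls_ev => n pi x /=; rewrite tK.
- move=> a; have [u ->] := cls_surj a; rewrite /= !OA_mapE.
  by apply: cls_ev => n pi x /=; rewrite tK'.
- by exists 1 => a; rewrite mul1r; exact: OA_map_norm.
- by exists 1 => a; rewrite mul1r; exact: OA_map_norm.
Qed.

Theorem theorem3 (R : realType) (Q1 Q2 : fin_digraph) :
  banach_isomorphic (OA R Q1) (OA R Q2) <-> digraph_isomorphic Q1 Q2.
Proof.
split; first exact: digraph_isomorphic_of_banach.
exact: banach_isomorphic_of_digraph.
Qed.
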